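(* Let $\varepsilon(n)=\frac{16(\log n)^{0.8}}{n}$. If $p=p(n)\in[0,1]$ satisfies $p\ge\frac{4\log n}{n}+\varepsilon(n)$, then a random temporal graph $\mathcal G\sim\mathcal F_{n,p}$ a.a.s. has an optimal spanner, i.e., a temporal spanner with exactly $2n-4$ edges.
   Context: A simple temporal graph is a pair $(G,\lambda)$ where $G=(V,E)$ is a finite simple undirected graph and $\lambda:E\to\mathbb R$ assigns a single time label to each edge. A temporal $(u,v)$-path is a path $u=u_0,\dots,u_\ell=v$ in $G$ with $\lambda(u_0u_1)\le\dots\le\lambda(u_{\ell-1}u_\ell)$. A temporal graph is temporally connected if every vertex has a temporal path to every other vertex. A temporal subgraph of $(G,\lambda)$ is $(G',\lambda|_{E(G')})$ with $G'$ a subgraph of $G$; a (temporal) spanner of $(G,\lambda)$ is a temporal subgraph with $V(G')=V(G)$ which is temporally connected. For $n\in\mathbb N$ and $p\in[0,1]$, the model $\mathcal F_{n,p}$: draw $G$ from the Erdős–Rényi model $G_{n,p}$ on $n$ labelled vertices and give each edge of $G$ an independent time label uniform in $[0,1]$. $\log$ is the natural logarithm; a.a.s. means with probability tending to $1$ as $n\to\infty$. *)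

(* Defs.v *)
From HB Require Import structures.
From mathcomp Require Import all_boot all_order all_algebra.
From mathcomp Require Import all_classical all_reals all_analysis.
Set Implicit Arguments.
Unset Strict Implicit.
Unset Printing Implicit Defensive.
Import Order.TTheory GRing.Theory Num.Theory.
Import numFieldNormedType.Exports.
Local Open Scope classical_set_scope.
Local Open Scope ring_scope.

Record sgraph (V : finType) := SGraph {
  edges : {set {set V}};
  edges_card2 : forall e, e \in edges -> #|e| = 2%N }.

Definition adj (V : finType) (G : sgraph V) : rel V :=
  fun x y => [set x; y]%SET \in edges G.

(* The labelling is a total function of the vertex subset, but its values
   outside the edge set are junk and are never looked at below. *)
Record tgraph (V : finType) (R : realType) := TGraph {
  graph :> sgraph V;
  label : {set V} -> R }.

(* u :: s is the vertex sequence u_0, ..., u_l. *)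
Definition temporal_path (V : finType) (R : realType) (G : tgraph V R)
    (u v : V) (s : seq V) : Prop :=
  [/\ path (adj G) u s, last u s = v, uniq (u :: s) &
      sorted <=%R (pairmap (fun x y => label G [set x; y]%SET) u s)].

Definition temporally_connected (V : finType) (R : realType)
    (G : tgraph V R) : Prop :=
  forall u v : V, u != v -> exists s : seq V, temporal_path G u v s.

(* H and G share the vertex type V, hence a temporal subgraph on V is
   automatically spanning. *)
Definition spanner (V : finType) (R : realType) (G H : tgraph V R) : Prop :=
  [/\ edges H \subset edges G,
      {in edges H, label H =1 label G} &
      temporally_connected H].

Definition has_optimal_spanner (V : finType) (R : realType)
    (G : tgraph V R) : Prop :=
  exists2 H : tgraph V R, spanner G H & #|edges H| = (2 * #|V| - 4)%N.

(* Law of the Erdos-Renyi random graph on the vertex set 'I_n. *)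
Definition gnp_pmf (R : realType) (n : nat) (p : R) (g : sgraph 'I_n) : R :=
  p ^+ #|edges g| * (1 - p) ^+ ('C(n, 2) - #|edges g|).

(* G, a random element on (T, P), is distributed as F_{n,p}: the underlying
   graph has law G_{n,p} and, conditionally on it being g, the labels of the
   edges of g are independent and uniform in [0, 1]. *)
Record is_Fnp d (T : measurableType d) (R : realType) (P : probability T R)
    (n : nat) (p : R) (G : T -> tgraph 'I_n R) : Prop := IsFnp {
  Fnp_measurable_graph : forall g : sgraph 'I_n,
    measurable [set w | edges (G w) = edges g];
  Fnp_measurable_label : forall e : {set 'I_n},
    measurable_fun [set w | e \in edges (G w)] (fun w => label (G w) e);
  Fnp_graph : forall g : sgraph 'I_n,
    P [set w | edges (G w) = edges g] = (gnp_pmf p g)%:E;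
  Fnp_label : forall (g : sgraph 'I_n) (B : {set 'I_n} -> set R),
    (forall e, measurable (B e)) ->
    P [set w | edges (G w) = edges g /\
               forall e, e \in edges g -> B e (label (G w) e)] =
    (P [set w | edges (G w) = edges g] *
     \prod_(e in edges g) uniform_prob (@ltr01 R) (B e))%E }.

Definition epsilon (R : realType) (n : nat) : R :=
  16 * (ln n%:R `^ (4 / 5)) / n%:R.

(* Main.v *)
(* Discretise time into an initial phase, two short middle cells A, B and a
   final phase.  Suppose a 4-cycle has edges labelled alternately in A, B, A, B,
   every vertex reaches the cycle during the initial phase, and every vertex is
   reached from it during the final phase.  The two forests witnessing this have
   n - 4 edges each and together with the 4 cycle edges form a spanner: within
   the cycle every vertex reaches every other by an A-edge followed by a B-edge.

   The set U of vertices reached from a 4-set by time t is a growth process: in a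
   cell of mass h it gains a vertex with probability about h |U| (n - |U|).  The
   potential phi(k) = (n - k) / (k - 1) is an eigenfunction of this chain with
   eigenvalue -(n - 1), so its mean after total mass t is at most about
   (n / 3) exp (- (n - 1) t), whereas phi is at least 1 / (n - 2) as long as some
   vertex is missed.  Hence each phase succeeds once n t = 2 ln n + 4 (ln n)^0.8.
   The middle cells have mass 4 (ln n)^0.8 / n each, which is enough for the
   second moment method to produce suitable 4-cycles, with one vertex in each of
   four classes of size n / 4; the growth from a given 4-set does not depend on
   the states of the edges inside it.  The masses add up to exactly
   (4 ln n + 16 (ln n)^0.8) / n. *)

Require Import Defs.
From HB Require Import structures.
From mathcomp Require Import all_boot all_order all_algebra.
From mathcomp Require Import all_classical all_reals all_analysis.
From mathcomp Require Import ring lra zify.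
Import Order.TTheory GRing.Theory Num.Theory.
Import numFieldNormedType.Exports.
Set Implicit Arguments.
Unset Strict Implicit.
Unset Printing Implicit Defensive.
Local Open Scope ring_scope.

(** * Growth of the reached set under product weights *)

Section ProductWeight.
Context {R : realType} {I S : finType}.
Implicit Types (nu : I -> S -> R) (s : {ffun I -> S}).

Definition weight nu s : R := \prod_i nu i (s i).

Lemma sum_weight nu : \sum_s weight nu s = \prod_i \sum_y nu i y.
Proof. by rewrite bigA_distr_bigA. Qed.

Lemma weight_ge0 nu s : (forall i y, 0 <= nu i y) -> 0 <= weight nu s.
Proof. by move=> nu0; apply: prodr_ge0. Qed.

(** A coordinatewise restriction keeps the product form. All conditioning below is done in this way:
    the weight is cut down and its total mass is carried along. *)
Lemma weight_restrict nu (A : I -> pred S) s :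
  weight (fun i y => nu i y * (A i y)%:R) s =
  weight nu s * [forall i, A i (s i)]%:R.
Proof.
rewrite /weight big_split /=; congr (_ * _).
case: forallP => [As|/forallP]; first by rewrite big1 // => i _; rewrite As.
rewrite negb_forall => /existsP[i nAi].
by rewrite (bigD1 i) //= (negbTE nAi) mul0r.
Qed.

End ProductWeight.

Section Growth.
Context {R : realType} {V S : finType}.
Implicit Types (U : {set V}) (s : {ffun {set V} -> S}) (c : S) (cs : seq S).
Implicit Types nu : {set V} -> S -> R.

(** Only one hop is made per cell, so the edges followed by a walk lie in distinct cells and the
    order of labels inside a cell never matters. *)
Definition grow_step s U c : {set V} :=
  U :|: [set v | [exists u in U, s [set u; v] == c]].

(** One process serves both phases: cells listed in increasing order give the vertices reached from
    [U], cells in decreasing order those that reach [U]. *)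
Definition grow s cs U : {set V} := foldl (grow_step s) U cs.

Definition cut U : {set {set V}} :=
  [set [set x.1; x.2] | x in finset.setX U (~: U)].

Lemma cutP U e :
  reflect (exists u v, [/\ u \in U, v \notin U & e = [set u; v]]) (e \in cut U).
Proof.
apply: (iffP imsetP) => [[[u v]]|[u [v [uU vU ->]]]].
  by rewrite !inE /= => /andP[uU vU] ->; exists u, v.
by exists (u, v); rewrite ?inE /= ?uU.
Qed.

Lemma card_cut U : #|cut U| = (#|U| * (#|V| - #|U|))%N.
Proof.
rewrite card_in_imset; first by rewrite cardsX [#|~: U|]cardsCs finset.setCK.
move=> [u v] [u' v']; rewrite !inE /= => /andP[uU vU] /andP[u'U v'U] /setP E.
have := E u; have := E v; rewrite !inE !eqxx ?orbT /=.
have -> : (v == u') = false by apply: contraNF vU => /eqP->.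
have -> : (u == v') = false by apply: contraNF v'U => /eqP<-.
by rewrite orbF /= => /esym/eqP -> /esym/eqP ->.
Qed.

Lemma card_cut_edge U e : e \in cut U -> #|e| = 2%N.
Proof.
case/cutP => u [v [uU vU ->]]; rewrite cards2.
by have -> : u != v by apply: contraNneq vU => <-.
Qed.

Lemma sub_grow_step s U c : U \subset grow_step s U c.
Proof. exact: finset.subsetUl. Qed.

Lemma sub_grow s cs U : U \subset grow s cs U.
Proof.
elim: cs U => //= c cs IH U.
exact: fintype.subset_trans (sub_grow_step s U c) (IH _).
Qed.

(** The step depends only on which cut edges lie in cell [c]; once that set is exposed, the new
    vertex set is determined. *)
Lemma grow_step_cut s U c :
  grow_step s U c = U :|: finset.cover [set e in cut U | s e == c].
Proof.
apply/setP => v; rewrite !inE; case: (boolP (v \in U)) => //= vU.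
apply/existsP/finset.bigcupP => [[u /andP[uU suv]]|[e]].
  exists [set u; v]; rewrite ?inE ?eqxx ?orbT // suv andbT.
  by apply/cutP; exists u, v.
rewrite inE => /andP[/cutP[u [w [uU wU ->]]] sc].
rewrite !inE => /orP[]/eqP vE; first by rewrite vE uU in vU.
by exists u; rewrite uU vE.
Qed.

Definition phi (k : nat) : R := (#|V|%:R - k%:R) / (k%:R - 1).

Lemma phi_homo (k l : nat) :
  (2 <= k <= #|V|)%N -> (k <= l)%N -> phi l <= phi k.
Proof.
move=> /andP[k2 kn] kl.
have [] : [/\ (2 <= k%:R :> R), (k%:R <= #|V|%:R :> R) & (k%:R <= l%:R :> R)].
  by rewrite !ler_nat.
rewrite /phi; set n := #|V|%:R; set x := k%:R; set y := l%:R => hx hn hy.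
rewrite ler_pdivrMr; last lra.
by rewrite mulrAC ler_pdivlMr; [nra|lra].
Qed.

(* [phi] is an eigenfunction of the pure birth chain [k -> k + 1] of rate
   [k * (#|V| - k)], with eigenvalue [- (#|V| - 1)]. *)
Lemma phi_diff (k : nat) : (2 <= k)%N ->
  (phi k - phi k.+1) * (k%:R * (#|V|%:R - k%:R)) = (#|V|%:R - 1) * phi k.
Proof.
move=> k2; have hk : 2 <= k%:R :> R by rewrite ler_nat.
rewrite /phi -addn1 natrD /=; field.
by rewrite !gt_eqF //; lra.
Qed.

(** Induction on [(1 - h) * (1 + (m + 1) * h) <= 1 + m * h]. It controls the probability that none
    of [m] cut edges lies in the current cell. *)
Lemma expr_one_minus_le (h : R) (m : nat) : 0 <= h <= 1 ->
  (1 - h) ^+ m <= (1 + m%:R * h)^-1.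
Proof.
move=> /andP[h0 h1].
have pos : 0 < 1 + m%:R * h by rewrite ltr_pwDl // mulr_ge0.
rewrite -[leRHS]mul1r ler_pdivlMr //.
elim: m pos => [|m IH] pos; first by rewrite expr0 mul0r addr0 mul1r.
have m0 : 0 <= m%:R * h by rewrite mulr_ge0.
have /IH {}IH : 0 < 1 + m%:R * h by lra.
rewrite exprSr -mulrA; apply: le_trans IH; apply: ler_wpM2l.
  by apply: exprn_ge0; lra.
by rewrite -addn1 natrD; nra.
Qed.

(** Factor by which one cell of mass [h] contracts the mean of [phi]. The numerator comes from the
    eigenvalue; the denominator is the price of discrete time, uniform in [#|U|] because a cut has
    at most [#|V| ^ 2] edges. *)
Definition rho (h : R) : R :=
  1 - (#|V|%:R - 1) * h / (1 + #|V|%:R ^+ 2 * h).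

(** Two outcomes are told apart: [U] stays, or it gains a vertex and [phi] drops to at most
    [phi #|U|.+1]. Staying forces every cut edge out of cell [c], and [phi_diff] turns the drop
    times the cut size into a multiple of [phi #|U|]. *)
Lemma grow_step_phi_le nu U c (h : R) :
  (forall e y, 0 <= nu e y) -> 0 <= h <= 1 -> (2 <= #|U|)%N ->
  (forall e, e \in cut U -> h * \sum_y nu e y <= nu e c) ->
  \sum_s weight nu s * phi #|grow_step s U c| <=
  rho h * phi #|U| * \sum_s weight nu s.
Proof.
(* To be used with [a], [b] the values [phi k], [phi k.+1], with [X] the bound on staying put, [n]
   the number [#|V| - 1] and [i] the inverse occurring in [rho]. *)
have alg (a b X i n : R) : n * a * h * i <= (a - b) * (1 - X) ->
    b + (a - b) * X <= (1 - n * h * i) * a by lra.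
move=> nu0 /andP[h0 h1] U2 hcut.
set k := #|U|; set M := \sum_s weight nu s.
have kn : (k <= #|V|)%N by exact: max_card.
have M0 : 0 <= M by apply: sumr_ge0 => s _; exact: weight_ge0.
have h01 : 0 <= h <= 1 by rewrite h0.
have dphi : 0 <= phi k - phi k.+1 by rewrite subr_ge0 phi_homo ?U2.
have stay : \sum_s weight nu s * (grow_step s U c == U)%:R <=
    (1 - h) ^+ #|cut U| * M.
  apply: (@le_trans _ _ (\sum_s weight (fun e y =>
      nu e y * ((e \in cut U) ==> (y != c))%:R) s)).
    apply: ler_sum => s _; rewrite weight_restrict.
    apply: ler_wpM2l; first exact: weight_ge0.
    case: eqP => // E; case: forallP => // -[] e; apply/implyP => ecut.
    case/cutP: (ecut) => u [v [uU vU eE]]; apply: contraNneq vU => sc.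
    by rewrite -E !inE; apply/orP; right; apply/existsP; exists u; rewrite uU -eE sc /=.
  rewrite /M !sum_weight; apply: (@le_trans _ _ (\prod_e
      ((if e \in cut U then 1 - h else 1) * \sum_y nu e y))).
    apply: ler_prod => e _; apply/andP; split.
      by apply: sumr_ge0 => y _; rewrite mulr_ge0.
    case: ifPn => ecut /=.
      have -> : \sum_y nu e y * (y != c)%:R = (\sum_y nu e y) - nu e c.
        rewrite (bigD1 c) //= eqxx mulr0 add0r [in RHS](bigD1 c) //=.
        rewrite [RHS]addrAC subrr add0r.
        by apply: eq_bigr => y ->; rewrite mulr1.
      have := hcut _ ecut.
      lra.
    by rewrite mul1r; apply: ler_sum => y _; rewrite mulr1.
  rewrite big_split /=; apply: ler_wpM2r.
    by apply: prodr_ge0 => e _; apply: sumr_ge0.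
  by rewrite -big_mkcond /= prodr_const.
have hphi s : phi #|grow_step s U c| <=
    phi k.+1 + (grow_step s U c == U)%:R * (phi k - phi k.+1).
  case: eqP => [->|/eqP ne]; first by rewrite mul1r addrC subrK.
  rewrite mul0r addr0.
  have lt : (k < #|grow_step s U c|)%N.
    apply: fintype.proper_card; rewrite finset.properEneq eq_sym ne.
    exact: sub_grow_step.
  apply: phi_homo => //; rewrite ltnS (leq_trans _ U2) //=.
  exact: leq_trans lt (max_card _).
apply: (@le_trans _ _ (phi k.+1 * M + (phi k - phi k.+1) * ((1 - h) ^+ #|cut U| * M))).
  apply: (@le_trans _ _ (phi k.+1 * M + (phi k - phi k.+1) *
     \sum_s weight nu s * (grow_step s U c == U)%:R)).
    rewrite /M !mulr_sumr -big_split /=; apply: ler_sum => s _.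
    rewrite (mulrC (phi k.+1)) (mulrC (phi k - _)) -mulrA -mulrDr.
    by apply: ler_wpM2l; [exact: weight_ge0 | exact: hphi].
  by rewrite lerD2l ler_wpM2l.
rewrite [X in _ + X]mulrA -mulrDl; apply: ler_wpM2r => //.
have := expr_one_minus_le #|cut U| h01.
rewrite card_cut -/k natrM natrB //.
set X := (1 - h) ^+ _; set n := #|V|%:R; set m := _ * (n - _).
have km : m <= n ^+ 2.
  rewrite /m expr2; apply: ler_pM => //; first by rewrite subr_ge0 ler_nat.
    by rewrite ler_nat.
  by rewrite gerBl.
have m0 : 0 <= m by rewrite /m mulr_ge0 // subr_ge0 ler_nat.
have E : (phi k - phi k.+1) * m = (n - 1) * phi k by exact: phi_diff.
clearbody m.
move=> hX; have {hX} : m * h / (1 + n ^+ 2 * h) <= 1 - X.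
  have : m * h / (1 + n ^+ 2 * h) <= 1 - (1 + m * h)^-1.
    have pos : 0 < 1 + m * h by rewrite ltr_pwDl // mulr_ge0.
    have -> : 1 - (1 + m * h)^-1 = m * h / (1 + m * h).
      by field; rewrite gt_eqF.
    apply: ler_wpM2l; first exact: mulr_ge0.
    rewrite lef_pV2 ?posrE //; first by rewrite lerD2l ler_wpM2r.
    by apply: (lt_le_trans pos); rewrite lerD2l ler_wpM2r.
  by move/le_trans; apply; rewrite lerD2l lerN2.
move/(ler_wpM2l dphi) => H; rewrite /rho -/n; apply: alg.
rewrite -E; have -> : (phi k - phi k.+1) * m * h / (1 + n ^+ 2 * h) =
  (phi k - phi k.+1) * (m * h / (1 + n ^+ 2 * h)) by rewrite -!mulrA.
exact: H.
Qed.

(* The weights are left unnormalised: fixing which cut edges lie in the current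
   cell again gives a product weight, and edges not inside the grown set still
   put a proportion at least [h] on each later cell. *)
Lemma grow_phi_le nu U cs (h : R) :
  (forall e y, 0 <= nu e y) -> 0 <= h <= 1 -> 0 <= rho h -> (2 <= #|U|)%N ->
  uniq cs ->
  (forall (e : {set V}) c, #|e| = 2%N -> ~~ (e \subset U) -> c \in cs ->
     h * \sum_y nu e y <= nu e c) ->
  \sum_s weight nu s * phi #|grow s cs U| <=
  rho h ^+ size cs * phi #|U| * \sum_s weight nu s.
Proof.
move=> nu0 h01 rho0; elim: cs nu nu0 U => [|c cs IH] nu nu0 U U2 /=.
  by move=> _ _; rewrite expr0 mul1r mulr_sumr; apply: ler_sum => s _; rewrite mulrC.
move=> /andP[ccs ucs] hnu.
(* [D s] is what the first step exposes. Fixing its value [B] constrains a cut edge only as to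
   whether its state is [c], and leaves all other subsets free. *)
pose D s := [set e in cut U | s e == c].
pose A (B : {set {set V}}) (e : {set V}) y := (e \in cut U) ==> ((y == c) == (e \in B)).
pose nuD B e y := nu e y * (A B e y)%:R.
have nuD0 B e y : 0 <= nuD B e y by rewrite mulr_ge0.
have DE s (B : {set {set V}}) : B \subset cut U -> (D s == B) = [forall e, A B e (s e)].
  move=> sB; apply/eqP/forallP => [<- e|AB]; first by apply/implyP => ec; rewrite inE ec.
  apply/setP => e; rewrite inE; case: (boolP (e \in cut U)) => /= ec.
    by have := AB e; rewrite /A ec => /eqP.
  by apply/esym/negbTE; apply: contra ec; apply: (fintype.subsetP sB).
have split_sum (F : {ffun {set V} -> S} -> R) :
    \sum_s weight nu s * F s =
    \sum_(B : {set {set V}} | B \subset cut U) \sum_s weight (nuD B) s * F s.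
  rewrite (partition_big D (fun B : {set {set V}} => B \subset cut U)) /=; last first.
    by move=> s _; apply/fintype.subsetP => e; rewrite inE => /andP[].
  apply: eq_bigr => B sB; rewrite big_mkcond /=; apply: eq_bigr => s _.
  rewrite /nuD weight_restrict -DE //; case: eqP => _; first by rewrite mulr1.
  by rewrite mulr0 mul0r.
have step_bound (B : {set {set V}}) : B \subset cut U ->
    \sum_s weight (nuD B) s * phi #|grow s cs (grow_step s U c)| <=
    \sum_s weight (nuD B) s * (rho h ^+ size cs * phi #|grow_step s U c|).
  move=> sB; set U' := U :|: finset.cover B.
  have UU' s : weight (nuD B) s != 0 -> grow_step s U c = U'.
    rewrite /nuD weight_restrict -DE // /U'.
    have [<- _|_] := eqVneq (D s) B; last by rewrite mulr0 eqxx.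
    exact: grow_step_cut.
  rewrite (eq_bigr (fun s => weight (nuD B) s * phi #|grow s cs U'|)); last first.
    move=> s _; have [->|/UU'->//] := eqVneq (weight (nuD B) s) 0.
    by rewrite !mul0r.
  rewrite [leRHS](eq_bigr (fun s => weight (nuD B) s * (rho h ^+ size cs * phi #|U'|))); last first.
    move=> s _; have [->|/UU'->//] := eqVneq (weight (nuD B) s) 0.
    by rewrite !mul0r.
  rewrite -mulr_suml [leRHS]mulrC; apply: IH => //.
    by apply: (leq_trans U2); apply/subset_leq_card/finset.subsetUl.
  move=> e c' e2 eU' c'cs.
  have eU : ~~ (e \subset U).
    by apply: contra eU' => /fintype.subset_trans; apply; apply: finset.subsetUl.
  (* [U'] covers [B], so an edge not inside [U'] is outside [B]. Since [c'] differs from [c], the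
     restriction keeps its weight on [c'], while its total weight can only shrink. *)
  have eB : e \notin B.
    apply: contra eU' => eB; apply/fintype.subsetP => v ve; rewrite inE; apply/orP; right.
    by apply/finset.bigcupP; exists e.
  have cc' : c' != c by apply: contraNneq ccs => <-.
  have -> : nuD B e c' = nu e c'.
    by rewrite /nuD /A (negbTE eB) (negbTE cc') implybT mulr1.
  have {}hnu := hnu e c' e2 eU (mem_behead (s:=c::cs) c'cs).
  apply: le_trans hnu; case/andP: h01 => h0 _; apply: ler_wpM2l => //.
  apply: ler_sum => y _; rewrite /nuD -[leRHS]mulr1.
  by apply: ler_wpM2l => //; case: (A _ _ _).
rewrite split_sum; apply: (le_trans (ler_sum _ step_bound)).
rewrite -split_sum.
rewrite [leLHS](eq_bigr (fun s =>
    rho h ^+ size cs * (weight nu s * phi #|grow_step s U c|))); last first.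
  by move=> s _; rewrite mulrCA.
rewrite -mulr_sumr exprSr -[rho h ^+ _ * rho h * _]mulrA -[leRHS]mulrA.
apply: ler_wpM2l; first exact: exprn_ge0.
apply: grow_step_phi_le => // e /[dup] /card_cut_edge e2 /cutP[u [v [uU vU eE]]].
apply: hnu; rewrite ?mem_head //; apply: contra vU => /fintype.subsetP; apply.
by rewrite eE !inE eqxx orbT.
Qed.

(** Markov's inequality: [#|V| * phi k >= 1] as long as [2 <= k < #|V|]. *)
Lemma grow_fail_le nu U cs (h : R) :
  (forall e y, 0 <= nu e y) -> 0 <= h <= 1 -> 0 <= rho h -> (2 <= #|U|)%N ->
  uniq cs ->
  (forall (e : {set V}) c, #|e| = 2%N -> ~~ (e \subset U) -> c \in cs ->
     h * \sum_y nu e y <= nu e c) ->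
  \sum_s weight nu s * (grow s cs U != [set: V])%:R <=
  #|V|%:R * (rho h ^+ size cs * phi #|U|) * \sum_s weight nu s.
Proof.
move=> nu0 h01 rho0 U2 ucs hnu.
rewrite -mulrA; apply: le_trans (ler_wpM2l _ (grow_phi_le nu0 h01 rho0 U2 ucs hnu)) => //.
rewrite mulr_sumr; apply: ler_sum => s _; rewrite mulrCA; apply: ler_wpM2l.
  exact: weight_ge0.
have gU : (2 <= #|grow s cs U|)%N by apply: (leq_trans U2); exact/subset_leq_card/sub_grow.
have gn : (#|grow s cs U| <= #|V|)%N by exact: max_card.
case: eqP => [E|/eqP E] /=.
  by rewrite mulr_ge0 // divr_ge0 // ?subr_ge0 ?ler_nat // -[1]/(1%:R) ler_nat; lia.
have : (#|grow s cs U| < #|V|)%N by rewrite -cardsT proper_card // finset.properEneq E finset.subsetT.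
rewrite /phi; move: gU gn; set k := #|grow s cs U| => k2 _ kn.
have : 2 <= k%:R :> R by rewrite ler_nat.
have : k%:R + 1 <= #|V|%:R :> R by rewrite natr1 ler_nat.
move: (k%:R : R) (#|V|%:R : R) => x n xn x2.
by rewrite mulrA ler_pdivlMr; [nra|lra].
Qed.

End Growth.

(** * Second moment of the number of 4-cycles *)

Section FourCycle.
Context {R : realType} {V S : finType} (m : nat).
Variable emb : 'I_4 -> 'I_m -> V.
Hypothesis emb_inj :
  forall j i j' i', emb j i = emb j' i' -> j = j' /\ i = i'.
Variables (A B : S) (cs_in cs_out : seq S).
Implicit Types (x : {ffun 'I_4 -> 'I_m}) (s : {ffun {set V} -> S}) (j : 'I_4).

(** [emb j] enumerates class [j], [x] chooses one vertex in each class, and [ordS] is the cyclic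
    successor on ['I_4]. *)
Definition cycle_edge x j : {set V} :=
  [set emb j (x j); emb (ordS j) (x (ordS j))].

Definition cycle_cell j : S := if odd j then B else A.

Definition cycle_vertices x : {set V} := [set emb j (x j) | j : 'I_4].

Definition cycle_at x s := [forall j, s (cycle_edge x j) == cycle_cell j].

Definition good_cycle x s :=
  [&& cycle_at x s, grow s cs_in (cycle_vertices x) == [set: V] &
      grow s cs_out (cycle_vertices x) == [set: V]].

Let shared x x' :=
  [set j | (x j == x' j) && (x (ordS j) == x' (ordS j))].

Lemma ordS4_neq j : (ordS j == j) = false /\ (ordS (ordS j) == j) = false.
Proof. by case: j => [[|[|[|[|]]]]]. Qed.

(** An edge determines its two classes, and these determine the position [j] because two cyclic
    steps never lead back to the start. *)
Lemma cycle_edge_inj x x' j j' : cycle_edge x j = cycle_edge x' j' ->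
  j = j' /\ j \in shared x x'.
Proof.
move=> /setP E; have [n1 n2] := ordS4_neq j; have [n3 n4] := ordS4_neq j'.
have := E (emb j (x j)); have := E (emb (ordS j) (x (ordS j))).
rewrite !inE !eqxx orbT /= => /esym/orP e1 /esym/orP e2.
case: e2 => /eqP/emb_inj[j1 xj].
  case: e1 => /eqP/emb_inj[j2 xSj]; first by rewrite j2 j1 eqxx in n1.
  by split=> //; rewrite xj xSj j1 !eqxx.
case: e1 => /eqP/emb_inj[j2 _].
  by move: n4; rewrite -j1 j2 eqxx.
by rewrite j2 -j1 eqxx in n1.
Qed.

Lemma card_cycle_edge x j : #|cycle_edge x j| = 2%N.
Proof.
rewrite cards2; case: eqP => // /emb_inj[E _].
by case: (ordS4_neq j); rewrite -E eqxx.
Qed.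

Lemma card_cycle_vertices x : #|cycle_vertices x| = 4%N.
Proof. by rewrite card_imset ?card_ord // => j j' /emb_inj[]. Qed.

Lemma cycle_edge_sub x j : cycle_edge x j \subset cycle_vertices x.
Proof. by apply/fintype.subsetP => v; rewrite !inE => /orP[]/eqP->; apply: imset_f. Qed.

Let Ex x := [set cycle_edge x j | j : 'I_4].

Let card_Ex x : #|Ex x| = 4%N.
Proof. by rewrite card_imset ?card_ord // => j j' /cycle_edge_inj[]. Qed.

Let card_ExU x x' : (8 - #|shared x x'| <= #|Ex x :|: Ex x'|)%N.
Proof.
rewrite cardsU !card_Ex; apply: leq_sub2l.
apply: (@leq_trans #|[set cycle_edge x j | j in shared x x']|).
  apply/subset_leq_card/fintype.subsetP => e; rewrite inE.
  case/andP => /imsetP[j _ ->] /imsetP[j' _ /cycle_edge_inj[jj' sh]].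
  exact: imset_f.
exact: leq_imset_card.
Qed.

Variables (mu : {set V} -> S -> R) (q h : R).
Hypothesis mu_ge0 : forall e y, 0 <= mu e y.
Hypothesis mu_sum : forall e, \sum_y mu e y = 1.
Hypothesis mu_mid : forall (e : {set V}) j, #|e| = 2%N -> mu e (cycle_cell j) = q.
Hypothesis mu_out : forall (e : {set V}) c, #|e| = 2%N ->
  c \in cs_in ++ cs_out -> h <= mu e c.
Hypothesis q01 : 0 < q <= 1.
Hypothesis h01 : 0 <= h <= 1.
Hypothesis rho_ge0 : 0 <= @rho R V h.
Hypotheses (uniq_in : uniq cs_in) (uniq_out : uniq cs_out).
Hypothesis size_cs : size cs_in = size cs_out.

(** The event [cycle_at] written as one condition per coordinate, as [weight_restrict] requires. *)
Let C x (e : {set V}) y := [forall j, (cycle_edge x j == e) ==> (y == cycle_cell j)].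

Let cycle_atE x s : cycle_at x s = [forall e, C x e (s e)].
Proof.
apply/forallP/forallP => [H e|H j].
  by apply/forallP => j; apply/implyP => /eqP <-.
by have /forallP/(_ j) := H (cycle_edge x j); rewrite eqxx.
Qed.

Let sum_mu_C x e : e \in Ex x -> \sum_y mu e y * (C x e y)%:R = q.
Proof.
case/imsetP => j _ ->; rewrite (bigD1 (cycle_cell j)) //= big1 ?addr0 => [|y yj].
  rewrite mu_mid ?card_cycle_edge //.
  have -> : C x (cycle_edge x j) (cycle_cell j); last by rewrite mulr1.
  by apply/forallP => j'; apply/implyP => /eqP/cycle_edge_inj[->].
case: (boolP (C _ _ _)); last by rewrite mulr0.
by move/forallP/(_ j); rewrite eqxx (negbTE yj).
Qed.

Let C_notin x e y : e \notin Ex x -> C x e y.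
Proof.
move=> ex; apply/forallP => j; apply/implyP => /eqP E.
by case/negP: ex; apply/imsetP; exists j.
Qed.

Lemma prob_cycle_at x : \sum_s weight mu s * (cycle_at x s)%:R = q ^+ 4.
Proof.
under eq_bigr do rewrite cycle_atE -weight_restrict.
rewrite sum_weight (eq_bigr (fun e => if e \in Ex x then q else 1)); last first.
  move=> e _; case: ifPn => [|ex]; first exact: sum_mu_C.
  by rewrite -[RHS](mu_sum e); apply: eq_bigr => y _; rewrite C_notin // mulr1.
by rewrite -big_mkcond /= prodr_const card_Ex.
Qed.

(** Every edge in the union of the two cycles contributes a factor at most [q], and the union has at
    least [8 - #|shared x x'|] edges. *)
Lemma prob_cycle_at2 x x' :
  \sum_s weight mu s * (cycle_at x s && cycle_at x' s)%:R <=
  q ^+ (8 - #|shared x x'|).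
Proof.
case/andP: q01 => q0 q1.
pose CC e y := C x e y && C x' e y.
have -> : \sum_s weight mu s * (cycle_at x s && cycle_at x' s)%:R =
    \sum_s weight (fun e y => mu e y * (CC e y)%:R) s.
  apply: eq_bigr => s _; rewrite weight_restrict !cycle_atE; congr (_ * _%:R).
  congr (nat_of_bool _); apply/andP/forallP => [[/forallP H /forallP H'] e|H].
    by rewrite /CC H H'.
  by split; apply/forallP => e; case/andP: (H e).
rewrite sum_weight.
apply: (@le_trans _ _ (q ^+ #|Ex x :|: Ex x'|)); last first.
  by apply: ler_wiXn2l; rewrite ?(ltW q0) // card_ExU.
rewrite -prodr_const [leRHS]big_mkcond /=; apply: ler_prod => e _; apply/andP; split.
  by apply: sumr_ge0 => y _; rewrite mulr_ge0.
case: ifPn => [|_]; last first.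
  by rewrite -[leRHS](mu_sum e); apply: ler_sum => y _; case: (CC _ _); rewrite ?mulr1 ?mulr0.
rewrite inE => /orP[] /sum_mu_C <-; apply: ler_sum => y _; apply: ler_wpM2l => //;
  rewrite /CC; by case: (C x e y); case: (C x' e y).
Qed.

Let eta : R := #|V|%:R * (@rho R V h ^+ size cs_out * @phi R V 4).

(** The cycle edges lie inside the 4-set, so restricting to [cycle_at] leaves the weights of all
    edges not inside it intact. Hence [grow_fail_le] applies to the restricted weight, whose total
    is [q ^+ 4]. *)
Lemma prob_cycle_fail x cs : uniq cs -> {subset cs <= cs_in ++ cs_out} ->
  size cs = size cs_out ->
  \sum_s weight mu s * (cycle_at x s && (grow s cs (cycle_vertices x) != [set: V]))%:R
    <= eta * q ^+ 4.
Proof.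
move=> ucs scs sz.
pose nu e y := mu e y * (C x e y)%:R.
have := @grow_fail_le R V S nu (cycle_vertices x) cs h.
rewrite card_cycle_vertices -/eta sz => /(_ _ h01 rho_ge0 isT ucs).
have E : \sum_s weight nu s = q ^+ 4.
  rewrite -(prob_cycle_at x); apply: eq_bigr => s _.
  by rewrite weight_restrict -cycle_atE.
rewrite E => H; apply: le_trans (H _ _).
- apply: ler_sum => s _; rewrite weight_restrict -cycle_atE -mulrA -natrM mulnb.
  by [].
- by move=> e y; rewrite mulr_ge0.
- move=> e c e2 eU /scs ccs.
  have ex : e \notin Ex x.
    by apply: contra eU => /imsetP[j _ ->]; exact: cycle_edge_sub.
  rewrite /nu C_notin // mulr1; apply: le_trans (mu_out e2 ccs).
  under eq_bigr do rewrite C_notin // mulr1.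
  by rewrite mu_sum mulr1.
Qed.

Lemma prob_good_cycle x :
  q ^+ 4 * (1 - 2 * eta) <= \sum_s weight mu s * (good_cycle x s)%:R.
Proof.
have h1 : \sum_s weight mu s * (cycle_at x s &&
    (grow s cs_in (cycle_vertices x) != [set: V]))%:R <= eta * q ^+ 4.
  by apply: prob_cycle_fail => // c; rewrite mem_cat => ->.
have h2 : \sum_s weight mu s * (cycle_at x s &&
    (grow s cs_out (cycle_vertices x) != [set: V]))%:R <= eta * q ^+ 4.
  by apply: prob_cycle_fail => // c; rewrite mem_cat orbC => ->.
have -> : q ^+ 4 * (1 - 2 * eta) = q ^+ 4 - (eta * q ^+ 4 + eta * q ^+ 4) by ring.
rewrite -{1}(prob_cycle_at x) lerBlDr.
apply: le_trans (lerD (lexx _) (lerD h1 h2)).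
rewrite -!big_split /=; apply: ler_sum => s _; rewrite -!mulrDr.
apply: ler_wpM2l; first exact: weight_ge0.
rewrite /good_cycle -!natrD ler_nat.
by case: cycle_at; case: (_ == _); case: (_ == _).
Qed.

(* Two 4-cycles with one vertex in each of four classes, agreeing in the classes
   [j] with [a j], share an edge for each cyclically consecutive agreement. *)
Lemma agreement_bound (Q : R) (a : 'I_4 -> bool) : 0 <= Q ->
  Q ^+ #|[set j | a j && a (ordS j)]| <=
  1 + Q * (\sum_j (a j)%:R * (a (ordS j))%:R)
    + Q ^+ 2 * (\sum_j (a j)%:R * (a (ordS j))%:R * (a (ordS (ordS j)))%:R)
    + Q ^+ 4 * \prod_j (a j)%:R.
Proof.
move=> Q0; have -> : #|[set j | a j && a (ordS j)]| = (\sum_j (a j && a (ordS j)))%N.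
  by rewrite -sum1dep_card big_mkcond /=; apply: eq_bigr => j _; case: (_ && _).
rewrite !big_ord_recr !big_ord0 /=.
pose b k := a (inord k).
have aE (i : 'I_4) : a i = b i by rewrite /b inord_val.
(* Of the 16 patterns, four agreements share 4 edges, three share 2, two adjacent ones share 1 and
   the others none; exactly three shared edges never occur. *)
rewrite !aE /=; case: (b 0%N); case: (b 1%N); case: (b 2%N); case: (b 3%N) => /=;
rewrite ?(mulr1, mulr0, mul0r, addr0, add0r, mul1r, expr0, expr1); 
have := sqr_ge0 Q; have := exprn_ge0 4 Q0; have := exprn_ge0 3 Q0; rewrite ?expr2; 
move: (Q ^+ 4) (Q ^+ 3) => *; nra.
Qed.

(** For fixed [x] the inner sum factorises over the classes, with factor [1] on [J] and [m] off
    [J]. *)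
Let agree_sum (J : {set 'I_4}) :
  \sum_(x : {ffun 'I_4 -> 'I_m}) \sum_(x' : {ffun 'I_4 -> 'I_m})
    \prod_j (if j \in J then (x j == x' j)%:R else 1) =
  (m ^ 4 * m ^ (4 - #|J|))%:R :> R.
Proof.
under eq_bigr => x _.
  rewrite -(bigA_distr_bigA (fun j y => if j \in J then (x j == y)%:R else 1)).
  rewrite (eq_bigr (fun j => if j \in J then 1 else m%:R)); last first.
    move=> j _; case: ifP => _; last by rewrite sumr_const card_ord.
    rewrite (bigD1 (x j)) //= eqxx big1 ?addr0 // => y.
    by rewrite eq_sym => /negbTE ->.
  rewrite (bigID (mem J)) /= big1 ?mul1r; last by move=> j ->.
  rewrite (eq_bigr (fun=> m%:R)) ?prodr_const; last by move=> j /negbTE ->.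
  over.
rewrite /= sumr_const card_ffun !card_ord -[LHS]mulr_natl natrM -[in LHS]natrX; congr (_ * (m ^ _)%:R).
have E : (#|J| + #|~: J|)%N = 4 by rewrite cardsC card_ord.
apply: (@eq_trans _ _ #|~: J|); last by rewrite -[X in (X - _)%N]E addKn.
by apply: eq_card => j; rewrite !inE.
Qed.

Let agree (x x' : {ffun 'I_4 -> 'I_m}) j : R := (x j == x' j)%:R.

Let agree_sum2 j : \sum_x \sum_x' agree x x' j * agree x x' (ordS j) = (m ^ 4 * m ^ 2)%:R.
Proof.
have [n1 n2] := ordS4_neq j.
have := agree_sum [set j; ordS j]; rewrite cards2 eq_sym n1 => <-.
apply: eq_bigr => x _; apply: eq_bigr => x' _; rewrite -big_mkcond /=.
by rewrite big_setU1 /= ?big_set1 // inE eq_sym n1.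
Qed.

Let agree_sum3 j : \sum_x \sum_x'
  agree x x' j * agree x x' (ordS j) * agree x x' (ordS (ordS j)) = (m ^ 4 * m)%:R.
Proof.
have [n1 n2] := ordS4_neq j; have [n3 _] := ordS4_neq (ordS j).
have := agree_sum (j |: [set ordS j; ordS (ordS j)]).
rewrite cardsU1 cards2 !inE ![j == _]eq_sym n1 n2 [ordS j == _]eq_sym n3 expn1 => <-.
apply: eq_bigr => x _; apply: eq_bigr => x' _; rewrite -big_mkcond /=.
rewrite big_setU1 /=; last by rewrite !inE ![j == _]eq_sym n1 n2.
by rewrite big_setU1 /= ?big_set1 ?mulrA // inE eq_sym n3.
Qed.

Let exchange_sum (f : _ -> _ -> 'I_4 -> R) (k : R) :
  (forall j, \sum_x \sum_x' f x x' j = k) ->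
  \sum_(x : {ffun 'I_4 -> 'I_m}) \sum_(x' : {ffun 'I_4 -> 'I_m}) \sum_j f x x' j =
  4 * k.
Proof.
move=> fk; under eq_bigr do rewrite exchange_big /=.
by rewrite exchange_big /= (eq_bigr _ (fun j _ => fk j)) sumr_const card_ord mulr_natl.
Qed.

Let agree_sum4 : \sum_x \sum_x' \prod_j agree x x' j = (m ^ 4)%:R.
Proof.
have := agree_sum [set: 'I_4]; rewrite cardsT card_ord subnn expn0 muln1 => <-.
apply: eq_bigr => x _; apply: eq_bigr => x' _; apply: eq_bigr => j _.
by rewrite inE.
Qed.

(** Relative excess of the second moment. The terms come from pairs of cycles sharing one edge (4
    positions), a path of two edges (4 positions), or all four edges. *)
Definition theta : R :=
  4 / (m%:R ^+ 2 * q) + 4 / (m%:R ^+ 3 * q ^+ 2) + 1 / (m%:R ^+ 4 * q ^+ 4).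

Lemma prob_cycle_second_moment : (0 < m)%N ->
  \sum_x \sum_x' \sum_s weight mu s * (cycle_at x s && cycle_at x' s)%:R <=
  (m%:R ^+ 4 * q ^+ 4) ^+ 2 * (1 + theta).
Proof.
move=> m0; case/andP: q01 => q0 q1.
have mR : 0 < m%:R :> R by rewrite ltr0n.
have Q0 : 0 <= q^-1 by rewrite invr_ge0 ltW.
apply: (@le_trans _ _ (\sum_x \sum_x' q ^+ 8 * (1
    + q^-1 * (\sum_j agree x x' j * agree x x' (ordS j))
    + q^-1 ^+ 2 * (\sum_j agree x x' j * agree x x' (ordS j) * agree x x' (ordS (ordS j)))
    + q^-1 ^+ 4 * \prod_j agree x x' j))).
  apply: ler_sum => x _; apply: ler_sum => x' _.
  apply: (le_trans (prob_cycle_at2 x x')).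
  have := agreement_bound (fun j => x j == x' j) Q0.
  move/(ler_wpM2l (exprn_ge0 8 (ltW q0))); apply: le_trans.
  rewrite -/(shared x x') exprVn -exprB ?unitfE ?gt_eqF //.
  by apply: (@leq_trans 4) => //; rewrite -[X in (_ <= X)%N](card_ord 4) max_card.
under eq_bigr do rewrite -mulr_sumr !big_split /= -!mulr_sumr.
rewrite -mulr_sumr !big_split /= -!mulr_sumr.
rewrite (exchange_sum agree_sum2) (exchange_sum agree_sum3) agree_sum4.
rewrite !sumr_const !card_ffun !card_ord /theta.
rewrite -mulrnA (natrM _ (m ^ 4) (m ^ 4)) (natrM _ (m ^ 4) (m ^ 2)).
rewrite (natrM _ (m ^ 4) m) (natrX _ m 4) (natrX _ m 2).
move: q0 mR; move: (m%:R : R) q => M k k0 M0.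
rewrite le_eqVlt; apply/orP; left; apply/eqP; field.
by rewrite !gt_eqF.
Qed.

(** The first moment counts good cycles but the second moment counts all cycles, so the growth
    process never enters a pair estimate. *)
Lemma prob_exists_good_cycle : (0 < m)%N ->
  1 - 4 * eta - theta <=
  \sum_s weight mu s * [exists x, good_cycle x s]%:R.
Proof.
move=> m0; case/andP: q01 => q0 q1.
have mR : 0 < m%:R :> R by rewrite ltr0n.
(* With [Z] good cycles among [X] cycles, of which [l] are expected,
   [Z > 0] has indicator at least [2 Z / l - (X / l)^2]. *)
set l : R := m%:R ^+ 4 * q ^+ 4.
have l0 : 0 < l by rewrite mulr_gt0 // exprn_gt0.
pose Z s : R := \sum_x (good_cycle x s)%:R.
pose X s : R := \sum_x (cycle_at x s)%:R.
have ZX s : 0 <= Z s <= X s.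
  rewrite sumr_ge0 //=; apply: ler_sum => x _; rewrite ler_nat /good_cycle.
  by case: (cycle_at x s) => //=; case: (_ && _).
(* As [a <= b], the left side is at most [1 - (b / l - 1) ^+ 2]. *)
have alg (a b : R) : 0 <= a <= b -> 2 * l^-1 * a - l^-1 ^+ 2 * b ^+ 2 <= 1.
  have : 0 < l^-1 by rewrite invr_gt0.
  move: (l^-1) => k k0 /andP[a0 ab]; have := sqr_ge0 (k * b - 1); nra.
apply: (@le_trans _ _ (\sum_s weight mu s * (2 * l^-1 * Z s - l^-1 ^+ 2 * X s ^+ 2))).
  rewrite (eq_bigr (fun s => 2 * l^-1 * (weight mu s * Z s) -
      l^-1 ^+ 2 * (weight mu s * X s ^+ 2))); last by move=> s _; ring.
  rewrite sumrB -!mulr_sumr.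
  have h1 : m%:R ^+ 4 * (q ^+ 4 * (1 - 2 * eta)) <= \sum_s weight mu s * Z s.
    under eq_bigr do rewrite mulr_sumr.
    rewrite exchange_big /=.
    have <- : \sum_(x : {ffun 'I_4 -> 'I_m}) q ^+ 4 * (1 - 2 * eta) =
        m%:R ^+ 4 * (q ^+ 4 * (1 - 2 * eta)).
      by rewrite sumr_const card_ffun !card_ord -[LHS]mulr_natl natrX.
    by apply: ler_sum => x _; exact: prob_good_cycle.
  have h2 : \sum_s weight mu s * X s ^+ 2 <= l ^+ 2 * (1 + theta).
    apply: le_trans (prob_cycle_second_moment m0).
    rewrite le_eqVlt; apply/orP; left; apply/eqP.
    under eq_bigr => s _.
      rewrite expr2 big_distrlr mulr_sumr /=.
      under eq_bigr do rewrite mulr_sumr.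
      over.
    rewrite exchange_big; apply: eq_bigr => x _.
    rewrite exchange_big; apply: eq_bigr => x' _.
    by apply: eq_bigr => s _; rewrite -natrM mulnb.
  rewrite mulrA -/l in h1.
  have e1 : 2 * l^-1 * (l * (1 - 2 * eta)) = 2 - 4 * eta.
    by field; rewrite gt_eqF.
  have e2 : l^-1 ^+ 2 * (l ^+ 2 * (1 + theta)) = 1 + theta.
    by field; rewrite gt_eqF.
  have {}h1 := ler_wpM2l (_ : 0 <= 2 * l^-1) h1.
  have {}h2 := ler_wpM2l (_ : 0 <= l^-1 ^+ 2) h2.
  rewrite e1 in h1; rewrite e2 in h2.
  have -> : 1 - 4 * eta - theta = (2 - 4 * eta) - (1 + theta) by ring.
  apply: lerB; [apply: h1|apply: h2].
    by rewrite mulr_ge0 // invr_ge0 ltW.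
  exact: sqr_ge0.
apply: ler_sum => s _; apply: ler_wpM2l; first exact: weight_ge0.
case: existsP => [_|nex]; first exact: alg.
have -> : Z s = 0.
  by rewrite /Z big1 // => x _; case: (boolP (good_cycle x s)) => // g; case: nex; exists x.
by rewrite mulr0 add0r oppr_le0 -exprMn sqr_ge0.
Qed.

End FourCycle.

(** * From growth to a spanner *)

Section Journey.
Context {V S : finType}.
Implicit Types (F : {set {set V}}) (s : {ffun {set V} -> S}) (cs : seq S).

(* The cells along the walk form a subsequence of [cs]. *)
Inductive chain F s : seq S -> V -> V -> Prop :=
| chain_refl cs u : chain F s cs u u
| chain_skip c cs u v : chain F s cs u v -> chain F s (c :: cs) u v
| chain_step c cs u v w : [set u; v] \in F -> s [set u; v] = c ->
    chain F s cs v w -> chain F s (c :: cs) u w.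

Lemma chain_sub F F' s cs u v : F \subset F' ->
  chain F s cs u v -> chain F' s cs u v.
Proof.
move=> sF; elim=> {cs u v} [cs u|c cs u v _|c cs u v w uv sc _].
- exact: chain_refl.
- exact: chain_skip.
- by apply: chain_step => //; exact: (fintype.subsetP sF).
Qed.

(** Each new vertex keeps one edge to a parent in the previous set. The child is the only endpoint
    outside that set, so the edges of one step are distinct; those of different steps lie in
    different cells. *)
Lemma grow_forest s cs (U : {set V}) : uniq cs ->
  exists F, [/\ (#|F| + #|U|)%N = #|grow s cs U|,
    forall e, e \in F -> #|e| = 2%N /\ s e \in cs &
    forall v, v \in grow s cs U -> exists2 u, u \in U & chain F s cs u v].
Proof.
elim: cs U => [|c cs IH] U /=.
  move=> _; exists finset.set0; split=> [|e|v vU]; rewrite ?cards0 ?inE //.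
  by exists v => //; exact: chain_refl.
case/andP => ccs /(IH (grow_step s U c)) {IH} [F1 [cF1 sF1 chF1]].
set U' := grow_step s U c in cF1 chF1 *.
pose par v := odflt v [pick u in U | s [set u; v] == c].
have parP v : v \in U' :\: U -> par v \in U /\ s [set par v; v] = c.
  rewrite !inE => /andP[vU]; rewrite (negbTE vU) /= => /existsP[u /andP[uU suv]].
  rewrite /par; case: pickP => [w /andP[wU /eqP swv] //|/(_ u)].
  by rewrite uU suv.
pose F0 := [set [set par v; v] | v in U' :\: U].
have sF0 e : e \in F0 -> #|e| = 2%N /\ s e = c.
  case/imsetP => v vU ->; have [pU sc] := parP v vU; split=> //.
  rewrite cards2; have -> // : par v != v.
  by apply: contraTneq vU => <-; rewrite inE pU.
have cF0 : #|F0| = #|U' :\: U|.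
  apply: card_in_imset => v w vU wU /setP/(_ v).
  have [pU _] := parP w wU; rewrite !inE eqxx orbT => /esym/orP[]/eqP // vE.
  by move: vU; rewrite vE inE pU.
exists (F0 :|: F1); split.
- rewrite cardsU (_ : F0 :&: F1 = finset.set0); last first.
    apply/setP => e; rewrite !inE; apply/negbTE/negP => /andP[/sF0[_ sc] /sF1[_]].
    by rewrite sc (negbTE ccs).
  have := cardsID U U'; rewrite (finset.setIidPr (sub_grow_step s U c)) -cF0.
  by rewrite cards0 -/U' -cF1 subn0 => <-; rewrite (addnC #|F0|) -addnA (addnC #|F0|).
- move=> e; rewrite !inE => /orP[/sF0[e2 ->]|/sF1[e2 scs]]; first by rewrite eqxx.
  by rewrite scs orbT.
- move=> v /chF1[u uU' /(chain_sub (finset.subsetUr F0 F1)) ch].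
  case: (boolP (u \in U)) => uU; first by exists u => //; exact: chain_skip.
  have uD : u \in U' :\: U by rewrite inE uU uU'.
  have [pU sc] := parP u uD; exists (par u) => //.
  apply: chain_step ch => //; rewrite inE; apply/orP; left.
  by apply/imsetP; exists u.
Qed.

Variable f : {set V} -> nat.

(* Along the walk [f] increases strictly within the half-open range [a, b). *)
Inductive journey F : nat -> V -> nat -> V -> Prop :=
| journey_refl a b u : (a <= b)%N -> journey F a u b u
| journey_step a b u v w : [set u; v] \in F -> (a <= f [set u; v])%N ->
    journey F (f [set u; v]).+1 v b w -> journey F a u b w.

Lemma journey_weaken F a a' b u v : (a' <= a)%N ->
  journey F a u b v -> journey F a' u b v.
Proof.
move=> aa' j; case: j aa' => [x y w xy aa'|x y w t z wt xf j aa'].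
  by apply: journey_refl; exact: leq_trans xy.
by apply: journey_step j => //; exact: leq_trans xf.
Qed.

Lemma journey_trans F a b c u v w :
  journey F a u b v -> journey F b v c w -> journey F a u c w.
Proof.
move=> j; elim: j w c => {a b u v} [a b u ab|a b u v t uv af _ IH] w c j.
  exact: journey_weaken j.
by apply: journey_step uv af _; exact: IH.
Qed.

Lemma journey_edge F a b u v : [set u; v] \in F ->
  (a <= f [set u; v] < b)%N -> journey F a u b v.
Proof. by move=> uv /andP[af fb]; apply: journey_step uv af _; exact: journey_refl. Qed.

Lemma chain_journey F s (r : S -> nat) cs a b u v :
  (forall e, f e = r (s e)) -> (a <= b)%N ->
  all (fun c => a <= r c < b)%N cs -> pairwise (fun c d => r c < r d)%N cs ->
  chain F s cs u v -> journey F a u b v.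
Proof.
move=> fE ab acs pcs ch; elim: ch a ab acs pcs => {cs u v}
  [cs u a ab _ _|c cs u v _ IH a ab /= /andP[_ acs] /andP[_ pcs]|
   c cs u v w uv sc _ IH a ab /= /andP[/andP[ac cb] acs] /andP[cmin pcs]].
- exact: journey_refl.
- exact: IH.
- apply: journey_step uv _ _; rewrite fE sc //; apply: IH => //.
  apply/allP => d dcs; rewrite (allP cmin d dcs) /=.
  by case/andP: (allP acs d dcs).
Qed.

(** With decreasing ranks the chain is walked backwards: its tail gives a journey ending before rank
    [r c], and the head edge takes that rank. *)
Lemma chain_journey_rev F s (r : S -> nat) cs a b u v :
  (forall e, f e = r (s e)) -> (a <= b)%N ->
  all (fun c => a <= r c < b)%N cs -> pairwise (fun c d => r d < r c)%N cs ->
  chain F s cs u v -> journey F a v b u.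
Proof.
move=> fE ab acs pcs ch; elim: ch b ab acs pcs => {cs u v}
  [cs u b ab _ _|c cs u v _ IH b ab /= /andP[_ acs] /andP[_ pcs]|
   c cs u v w uv sc _ IH b ab /= /andP[/andP[ac cb] acs] /andP[cmax pcs]].
- exact: journey_refl.
- exact: IH.
- apply: (@journey_trans _ _ (r c) _ _ v).
    apply: IH => //; apply/allP => d dcs; rewrite (allP cmax d dcs) andbT.
    by case/andP: (allP acs d dcs).
  by apply: journey_edge; rewrite finset.setUC // fE sc leqnn.
Qed.

(** Each vertex meets one edge of rank [N] and one of rank [N.+1]. Either edge alone reaches a
    neighbour; the first followed by the second at its far end reaches the opposite vertex. *)
Lemma four_cycle_journey F N v0 v1 v2 v3 :
  [set v0; v1] \in F -> f [set v0; v1] = N ->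
  [set v1; v2] \in F -> f [set v1; v2] = N.+1 ->
  [set v2; v3] \in F -> f [set v2; v3] = N ->
  [set v3; v0] \in F -> f [set v3; v0] = N.+1 ->
  {in [set v0; v1; v2; v3] &, forall u v, journey F N u N.+2 v}.
Proof.
move=> e01 f01 e12 f12 e23 f23 e30 f30.
have E1 u v : [set u; v] \in F -> f [set u; v] = N -> journey F N u N.+1 v.
  by move=> uv fuv; apply: journey_edge uv _; rewrite fuv leqnn ltnSn.
have E2 u v : [set u; v] \in F -> f [set u; v] = N.+1 -> journey F N.+1 u N.+2 v.
  by move=> uv fuv; apply: journey_edge uv _; rewrite fuv leqnn ltnSn.
have j01 := E1 _ _ e01 f01; have j23 := E1 _ _ e23 f23.
have j12 := E2 _ _ e12 f12; have j30 := E2 _ _ e30 f30.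
rewrite finset.setUC in e01 f01; rewrite finset.setUC in e23 f23.
rewrite finset.setUC in e12 f12; rewrite finset.setUC in e30 f30.
have j10 := E1 _ _ e01 f01; have j32 := E1 _ _ e23 f23.
have j21 := E2 _ _ e12 f12; have j03 := E2 _ _ e30 f30.
have r1 u : journey F N u N.+1 u by exact: journey_refl.
have r2 u : journey F N.+1 u N.+2 u by exact: journey_refl.
move=> u v; rewrite !inE -!orbA => /or4P[]/eqP-> /or4P[]/eqP->;
first [ by apply: journey_refl; rewrite (leq_trans (leqnSn N))
      | by apply: (journey_trans (r1 _)); assumption
      | by apply: journey_trans (r2 _); assumption
      | by apply: journey_trans j01 _; assumption
      | by apply: journey_trans j10 _; assumption
      | by apply: journey_trans j23 _; assumption
      | by apply: journey_trans j32 _; assumption ].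
Qed.

Lemma journey_path F a b u v : journey F a u b v ->
  exists p, [/\ path (fun x y => [set x; y] \in F) u p, last u p = v,
    uniq (u :: p) &
    let l := map f (pairmap (fun x y => [set x; y]) u p) in
    all (leq a) l /\ sorted ltn l].
Proof.
elim=> {a b u v} [a b u _|a b u v w uv af _ [p [pp lp up [al sl]]]].
  by exists [::].
case: (boolP (u \in v :: p)) => [|uvp]; last first.
  exists (v :: p); split; rewrite /= ?uv ?uvp //; split.
    rewrite af /=; apply: sub_all al => x; exact: leq_trans (leqW af).
  by rewrite path_min_sorted.
(* If [u] recurs, the closed walk back to it is cut out. The remaining ranks form a suffix, so they
   still increase and stay at least [a]. *)
rewrite inE => /predU1P[->|/splitPr up'].
  exists p; split=> //; split=> //.
  by apply: sub_all al => x; exact: leq_trans (leqW af).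
case: up' pp lp up al sl => p1 p2.
rewrite cat_path last_cat /= => /and3P[_ _ pp] lp.
rewrite cat_uniq => /and4P[_ _ _ up].
rewrite pairmap_cat map_cat all_cat /= => /and3P[_ _ al] sl.
exists p2; split=> //.
split; first by apply: sub_all al => x; exact: leq_trans (leqW af).
by case/cat_sorted2: sl => _ /path_sorted.
Qed.

End Journey.

(** Ranks increase strictly along a journey, so labels need to be compared only across different
    ranks. *)
Lemma journeys_optimal_spanner (R : realType) (V : finType) (G : tgraph V R)
    (F : {set {set V}}) (f : {set V} -> nat) (K : nat) :
  F \subset edges G ->
  {in F &, forall e e', (f e < f e')%N -> label G e <= label G e'} ->
  #|F| = (2 * #|V| - 4)%N ->
  (forall u v, journey f F 0 u K v) ->
  has_optimal_spanner G.
Proof.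
move=> sF mono cF jF.
have F2 e : e \in F -> #|e| = 2%N by move/(fintype.subsetP sF); exact: edges_card2.
exists (TGraph (SGraph F2) (label G)) => //; split=> //= u v uv.
have [p [pp lp up [_ sl]]] := journey_path (jF u v).
exists p; split=> //.
have -> : pairmap (fun x y => label G [set x; y]) u p =
    map (label G) (pairmap (fun x y => [set x; y]) u p).
  by elim: p u {uv pp lp up sl} => //= x p IH u; rewrite IH.
have {}pp : all [in F] (pairmap (fun x y => [set x; y]) u p).
  by elim: p u pp {uv lp up sl} => //= x p IH u /andP[-> /IH].
rewrite sorted_map in sl; rewrite sorted_map.
exact: sub_in_sorted pp sl.
Qed.

(** The in-forest, the cycle and the out-forest have ranks in [[0, N)], [[N, N + 2)] and
    [[N + 2, K)]. They are therefore disjoint, and one journey from each range can be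
    concatenated. *)
Lemma good_cycle_journeys (V S : finType) (m : nat) (emb : 'I_4 -> 'I_m -> V)
    (A B : S) (cs_in cs_out : seq S) (r : S -> nat) (N K : nat)
    (s : {ffun {set V} -> S}) (x : {ffun 'I_4 -> 'I_m}) :
  (forall j i j' i', emb j i = emb j' i' -> j = j' /\ i = i') ->
  r A = N -> r B = N.+1 -> (N.+2 <= K)%N ->
  uniq cs_in -> uniq cs_out ->
  all (fun c => 0 <= r c < N)%N cs_in ->
  all (fun c => N.+2 <= r c < K)%N cs_out ->
  pairwise (fun c d => r d < r c)%N cs_in ->
  pairwise (fun c d => r c < r d)%N cs_out ->
  good_cycle emb A B cs_in cs_out x s ->
  exists F : {set {set V}}, [/\ #|F| = (2 * #|V| - 4)%N,
    forall e, e \in F -> (r (s e) < K)%N &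
    forall u v, journey (fun e => r (s e)) F 0 u K v].
Proof.
move=> emb_inj rA rB NK uin uout ain aout pin pout /and3P[/forallP cyc /eqP gin /eqP gout].
have [F1 [cF1 sF1 ch1]] := grow_forest s (cycle_vertices emb x) uin.
have [F3 [cF3 sF3 ch3]] := grow_forest s (cycle_vertices emb x) uout.
rewrite gin cardsT card_cycle_vertices // in cF1.
rewrite gout cardsT card_cycle_vertices // in cF3.
pose F2 := [set cycle_edge emb x j | j : 'I_4].
have cF2 : #|F2| = 4%N.
  by rewrite card_imset ?card_ord // => j j' /(cycle_edge_inj emb_inj)[].
have r1 e : e \in F1 -> (r (s e) < N)%N by case/sF1 => _ /(allP ain).
have r3 e : e \in F3 -> (N.+2 <= r (s e) < K)%N by case/sF3 => _ /(allP aout).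
have r2 e : e \in F2 -> (N <= r (s e) < N.+2)%N.
  case/imsetP => j _ ->; rewrite (eqP (cyc j)) /cycle_cell.
  by case: odd; rewrite ?rA ?rB ?leqnn ?leqnSn ?ltnS ?leqnn ?leqnSn.
exists (F1 :|: F2 :|: F3); split.
- have d12 : F1 :&: F2 = finset.set0.
    by apply/setP => e; rewrite !inE; apply/negbTE/negP => /andP[/r1 h /r2]; lia.
  have d3 : (F1 :|: F2) :&: F3 = finset.set0.
    apply/setP => e; rewrite !inE; apply/negbTE/negP => /andP[/orP[/r1|/r2] h /r3]; lia.
  rewrite !cardsU d12 d3 !cards0 !subn0 cF2; move: cF1 cF3.
  by move: #|F1| #|F3| #|V| => a b n; lia.
- by move=> e; rewrite !inE => /orP[/orP[/r1|/r2]|/r3]; lia.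
move=> u v; set F := _ :|: F3.
have [u' u'C /(chain_sub (F' := F))] : exists2 u', u' \in cycle_vertices emb x &
    chain F1 s cs_in u' u by apply: ch1; rewrite gin inE.
move=> /(_ _)/(chain_journey_rev (fun e => erefl (r (s e))) (leq0n N) ain pin) j1.
have [v' v'C /(chain_sub (F' := F))] : exists2 v', v' \in cycle_vertices emb x &
    chain F3 s cs_out v' v by apply: ch3; rewrite gout inE.
move=> /(_ _)/(chain_journey (fun e => erefl (r (s e))) NK aout pout) j3.
apply: journey_trans (j1 _) (journey_trans _ (j3 _)).
- by rewrite /F -finset.setUA finset.subsetUl.
- have inF j : cycle_edge emb x j \in F by rewrite !inE imset_f ?orbT.
  pose w k := emb (inord k) (x (inord k)).
  have wE k : (k < 4)%N -> cycle_edge emb x (inord k) = [set w k; w (k.+1 %% 4)%N].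
    move=> k4; rewrite /cycle_edge /w.
    suff -> : ordS (inord k) = inord (k.+1 %% 4)%N :> 'I_4 by [].
    by apply: val_inj; rewrite /= !inordK // ltn_pmod.
  have wF k : (k < 4)%N -> [set w k; w (k.+1 %% 4)%N] \in F.
    by move=> k4; rewrite -wE.
  have wr k : (k < 4)%N -> r (s [set w k; w (k.+1 %% 4)%N]) = if odd k then N.+1 else N.
    move=> k4; rewrite -wE // (eqP (cyc _)) /cycle_cell inordK //.
    by case: odd.
  have CE : cycle_vertices emb x \subset [set w 0%N; w 1%N; w 2%N; w 3%N].
    apply/fintype.subsetP => y /imsetP[j _ ->].
    have -> : emb j (x j) = w j by rewrite /w inord_val.
    by rewrite !inE; case: j => [[|[|[|[|]]]]] //= _; rewrite eqxx ?orbT.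
  exact: (four_cycle_journey (wF 0%N isT) (wr 0%N isT) (wF 1%N isT) (wr 1%N isT)
     (wF 2%N isT) (wr 2%N isT) (wF 3%N isT) (wr 3%N isT)
     (fintype.subsetP CE _ u'C) (fintype.subsetP CE _ v'C)).
- exact: finset.subsetUr.
Qed.

Local Open Scope classical_set_scope.

(** * Discretisation of the random temporal graph *)

Section FiniteFibers.
Context d (T : measurableType d) (R : realType) (P : probability T R).
Context (I : finType) (X : T -> I).
Hypothesis mX : forall i, measurable [set w | X w = i].

Lemma measurable_finite_preimage (A : set I) : measurable [set w | A (X w)].
Proof.
have -> : [set w | A (X w)] = \bigcup_(i in A) [set w | X w = i].
  apply/seteqP; split=> [w Aw|w [i Ai /= E]]; first by exists (X w).
  by rewrite /= E.
by apply: fin_bigcup_measurable => //; exact: finite_finset.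
Qed.

Lemma measure_finite_fibers (A : set T) : measurable A ->
  P A = (\sum_i P (A `&` [set w | X w = i]))%E.
Proof.
move=> mA; rewrite /index_enum -[Finite.enum _]enumT fsbig_seq ?enum_uniq //.
rewrite -measure_fin_bigcup //=.
- congr (P _); apply/seteqP; split=> [w Aw|w [i _ []]] //.
  by exists (X w) => //=; rewrite mem_enum.
- by move=> i j _ _ [w [[_ <-] [_ <-]]].
- by move=> i _; apply: measurableI.
Qed.

End FiniteFibers.

(** * Measurability of the spanner event and the product law of the edge states *)

Section Transfer.
Context d (T : measurableType d) (R : realType) (P : probability T R).
Variables (n : nat) (p : R) (G : T -> tgraph 'I_n R).
Hypothesis FG : is_Fnp P p G.
Implicit Types (e : {set 'I_n}) (g : {set {set 'I_n}}).

Lemma measurable_edges g : measurable [set w | edges (G w) = g].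
Proof.
have [/forallP g2|/forallPn[e]] := boolP [forall e, (e \in g) ==> (#|e| == 2%N)].
  have g2' e : e \in g -> #|e| = 2%N by move=> eg; have := g2 e; rewrite eg => /eqP.
  exact: (Fnp_measurable_graph FG (SGraph g2')).
rewrite negb_imply => /andP[eg e2].
rewrite (_ : [set w | _] = set0) //; apply/seteqP; split=> // w /= E.
by case/eqP: e2; apply: (@edges_card2 _ (G w)); rewrite E.
Qed.

Lemma measurable_mem_edges e : measurable [set w | e \in edges (G w)].
Proof.
have := @measurable_finite_preimage _ _ _ (fun w => edges (G w)) measurable_edges (fun g => e \in g).
exact.
Qed.

Let leb w e e' := [&& e \in edges (G w), e' \in edges (G w) &
  label (G w) e <= label (G w) e'].

Let measurable_leb e e' : measurable [set w | leb w e e'].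
Proof.
have -> : [set w | leb w e e'] =
  ([set w | e \in edges (G w)] `&` [set w | e' \in edges (G w)]) `&`
  [set w | label (G w) e <= label (G w) e'].
  apply/seteqP; split=> [w /and3P[? ? ?]|w [[? ?] ?]] //=.
  by apply/and3P; split.
apply: measurable_fun_le.
- by apply: measurableI; exact: measurable_mem_edges.
- exact: (measurable_funS (@measurable_mem_edges e) (@subIsetl _ _ _) (@Fnp_measurable_label _ _ _ _ _ _ _ FG e)).
- exact: (measurable_funS (@measurable_mem_edges e') (@subIsetr _ _ _) (@Fnp_measurable_label _ _ _ _ _ _ _ FG e')).
Qed.

(* Only finitely many comparisons of labels decide whether a spanner exists. *)
Let code w : {set {set 'I_n}} * {set {set 'I_n} * {set 'I_n}} :=
  (edges (G w), [set ee | leb w ee.1 ee.2]%SET).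

Let measurable_code c : measurable [set w | code w = c].
Proof.
case: c => g r.
have -> : [set w | code w = (g, r)] = [set w | edges (G w) = g] `&`
    \bigcap_(ee in [set: {set 'I_n} * {set 'I_n}])
      [set w | leb w ee.1 ee.2 = (ee \in r)].
  apply/seteqP; split=> [w [eg er]|w [eg er]].
    by split=> // ee _ /=; rewrite -er inE.
  congr pair => //; apply/setP => ee; rewrite inE; exact: er.
apply: measurableI; first exact: measurable_edges.
apply: fin_bigcap_measurable => [|ee _]; first exact: finite_finset.
case: (ee \in r); first exact: measurable_leb.
rewrite (_ : [set w | _] = ~` [set w | leb w ee.1 ee.2]).
  exact/measurableC/measurable_leb.
by apply/seteqP; split=> w /=; [move=> ->|move/negP/negbTE].
Qed.

(** The same edge set serves with the labels of [w']: a temporal path depends only on comparisons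
    between labels of edges, and [code] records them all. *)
Lemma code_has_optimal_spanner w w' : code w = code w' ->
  has_optimal_spanner (G w) -> has_optimal_spanner (G w').
Proof.
move=> [eE rE] [H [sH lH cH] cardH].
exists (TGraph H (label (G w'))); last exact: cardH.
split=> //=; first by rewrite -eE.
move=> u v /cH[s [ps ls us ss]]; exists s; split=> //=.
have le2 e e' : e \in edges H -> e' \in edges H ->
    label H e <= label H e' -> label (G w') e <= label (G w') e'.
  move=> eH e'H; rewrite !lH // => lee'.
  have : (e, e') \in [set ee | leb w ee.1 ee.2]%SET.
    by rewrite inE /leb !(fintype.subsetP sH) //.
  by rewrite rE inE => /and3P[].
have pairmapE (l : {set 'I_n} -> R) : pairmap (fun x y => l [set x; y]%SET) u s =
    map l (pairmap (fun x y => [set x; y]%SET) u s).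
  by elim: s u {ps ls us ss} => //= x s IH u; rewrite IH.
have alls : all [in edges H] (pairmap (fun x y => [set x; y]%SET) u s).
  elim: s u ps {ls us ss pairmapE} => //= x s IH u /andP[ux /IH ->].
  by rewrite andbT; exact: ux.
rewrite pairmapE sorted_map in ss; rewrite pairmapE sorted_map.
by apply: sub_in_sorted alls ss.
Qed.

Lemma measurable_has_optimal_spanner :
  measurable [set w | has_optimal_spanner (G w)].
Proof.
have -> : [set w | has_optimal_spanner (G w)] =
    [set w | (code @` [set w | has_optimal_spanner (G w)]) (code w)].
  apply/seteqP; split=> [w hw|w [w' hw' /code_has_optimal_spanner]]; last exact.
  by exists w.
exact: (measurable_finite_preimage measurable_code).
Qed.

Variables (S : finType) (none : S) (kappa : R -> S).
Hypothesis mkappa : forall y, measurable [set t | kappa t = y].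

Definition state w : {ffun {set 'I_n} -> S} :=
  [ffun e => if e \in edges (G w) then kappa (label (G w) e) else none].

Definition cell_prob y : R := fine (uniform_prob (@ltr01 R) [set t | kappa t = y]).

(* A subset that is not a pair is never an edge, so its state is always [none]. *)
Definition state_law e y : R :=
  if #|e| == 2%N then p * cell_prob y + (1 - p) * (y == none)%:R
  else (y == none)%:R.

Lemma sum_cell_prob : \sum_y cell_prob y = 1.
Proof.
have := measure_finite_fibers (uniform_prob (@ltr01 R)) mkappa measurableT.
rewrite probability_setT => E.
apply: EFin_inj; rewrite -sumEFin; apply/esym; apply: etrans E _.
apply: eq_bigr => y _; rewrite setTI /cell_prob fineK //.
by apply: fin_num_measure; exact: mkappa.
Qed.

Let compat g (f : {ffun {set 'I_n} -> S}) :=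
  [forall e, (e \in g) ==> (#|e| == 2%N)] && [forall e, (e \notin g) ==> (f e == none)].

Let state_edges_set g f : compat g f ->
  [set w | edges (G w) = g /\ state w = f] =
  [set w | edges (G w) = g /\
     forall e, e \in g -> [set t | kappa t = f e] (label (G w) e)].
Proof.
case/andP => _ /forallP gnone; apply/seteqP; split=> w [eg].
  by move=> <-; split=> // e eg'; rewrite /= ffunE eg eg'.
move=> lab; split=> //; apply/ffunP => e; rewrite ffunE eg; case: ifPn => [/lab //|ne].
by have := gnone e; rewrite ne => /eqP.
Qed.

Let state_edges_set0 g f : ~~ compat g f ->
  [set w | edges (G w) = g /\ state w = f] = set0.
Proof.
rewrite negb_and => nc; apply/seteqP; split=> // w /= [eg sf].
case/orP: nc => /forallPn[e]; rewrite negb_imply => /andP[eg' /eqP]; apply.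
  by apply: (@edges_card2 _ (G w)); rewrite eg.
by rewrite -sf ffunE eg (negbTE eg').
Qed.

Lemma measurable_state f : measurable [set w | state w = f].
Proof.
have -> : [set w | state w = f] =
   \bigcup_(g in setT) [set w | edges (G w) = g /\ state w = f].
  by apply/seteqP; split=> [w sf|w [g _ []]] //; exists (edges (G w)).
apply: fin_bigcup_measurable => [|g _]; first exact: finite_finset.
have [c|/state_edges_set0 -> //] := boolP (compat g f).
have -> : [set w | edges (G w) = g /\ state w = f] =
   [set w | edges (G w) = g] `&` \bigcap_(e in [set e | e \in g])
     ([set w | e \in edges (G w)] `&` (fun w => label (G w) e) @^-1` [set t | kappa t = f e]).
  rewrite state_edges_set //; apply/seteqP; split=> w [eg lab].
    by split=> // e eg' /=; split; [rewrite eg|exact: lab].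
  by split=> // e /lab [].
apply: measurableI; first exact: measurable_edges.
apply: fin_bigcap_measurable => [|e _]; first exact: finite_finset.
exact: (@Fnp_measurable_label _ _ _ _ _ _ _ FG e (@measurable_mem_edges e) _ (mkappa (f e))).
Qed.

(** Expanding the product of the sums [A e + B e] over edge sets [g] takes [A] on [g] and [B] off
    [g]. Each term is the probability of having edge set [g] and state [f], and it vanishes for
    incompatible [g]. *)
Lemma prob_state f : P [set w | state w = f] = (weight state_law f)%:E.
Proof.
rewrite (measure_finite_fibers P measurable_edges (measurable_state f)).
pose A e := if #|e| == 2%N then p * cell_prob (f e) else 0.
pose B e := if #|e| == 2%N then (1 - p) * (f e == none)%:R else (f e == none)%:R.
have -> : weight state_law f = \prod_e (A e + B e).
  apply: eq_bigr => e _; rewrite /state_law /A /B.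
  by case: ifP => //; rewrite add0r.
rewrite bigA_distr -sumEFin; apply: eq_bigr => g _.
have -> : [set w | state w = f] `&` [set w | edges (G w) = g] =
    [set w | edges (G w) = g /\ state w = f].
  by apply/seteqP; split=> w [].
have [c|nc] := boolP (compat g f); last first.
  rewrite state_edges_set0 // measure0; apply/esym; congr EFin; move: nc.
  rewrite negb_and => /orP[]/forallPn[e]; rewrite negb_imply => /andP[eg h].
    by rewrite (bigD1 e) //= eg /A (negbTE h) mul0r.
  by rewrite (bigD1 e) //= (negbTE eg) /B (negbTE h) mulr0 if_same mul0r.
rewrite state_edges_set //; case/andP: c => /forallP c2 /forallP cnone.
have g2 e : e \in g -> #|e| = 2%N by move=> eg; have := c2 e; rewrite eg => /eqP.
rewrite (Fnp_label FG (SGraph g2) (B := fun e => [set t | kappa t = f e])) //.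
rewrite (Fnp_graph FG (SGraph g2)) /gnp_pmf /=.
rewrite (eq_bigr (fun e => (cell_prob (f e))%:E)); last first.
  by move=> e _; rewrite /cell_prob fineK //; apply: fin_num_measure; exact: mkappa.
rewrite prodEFin -EFinM; congr EFin.
rewrite [RHS](bigID [in g]) /= mulrAC; congr (_ * _).
  rewrite [RHS](eq_bigr (fun e => p * cell_prob (f e))).
    by rewrite big_split /= prodr_const.
  by move=> e eg; rewrite eg /A g2.
rewrite [RHS](bigID (fun e : {set 'I_n} => #|e| == 2%N)) /=.
rewrite [X in _ = _ * X]big1 ?mulr1; last first.
  move=> e /andP[eg e2]; rewrite (negbTE eg) /B (negbTE e2).
  by have := cnone e; rewrite eg => /= ->.
rewrite [RHS](eq_bigr (fun=> 1 - p)); last first.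
  move=> e /andP[eg e2]; rewrite (negbTE eg) /B e2.
  by have := cnone e; rewrite eg => /= ->; rewrite mulr1.
rewrite prodr_const; congr (_ ^+ _).
(* The exponent of [1 - p] counts the pairs outside [g]. *)
have -> : 'C(n, 2) = #|[set e : {set 'I_n} | #|e| == 2%N]%SET|.
  by rewrite card_draws card_ord.
rewrite -(cardsID g [set e : {set 'I_n} | #|e| == 2%N]%SET) (finset.setIidPr _); last first.
  by apply/fintype.subsetP => e /g2; rewrite inE => ->.
by rewrite addKn; apply: eq_card => e; rewrite !inE.
Qed.

Lemma prob_ge_weight (A : set T) (E : pred {ffun {set 'I_n} -> S}) :
  measurable A -> (forall w, E (state w) -> A w) ->
  ((\sum_f weight state_law f * (E f)%:R)%:E <= P A)%E.
Proof.
move=> mA EA.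
have mE : measurable [set w | E (state w)].
  exact: (measurable_finite_preimage measurable_state (fun f => E f)).
apply: le_trans (_ : (P [set w | E (state w)] <= _)%E); last first.
  by apply: le_measure; rewrite ?inE.
rewrite (measure_finite_fibers P measurable_state mE) -sumEFin.
apply: lee_sum => f _; case: (boolP (E f)) => Ef; last by rewrite mulr0 measure_ge0.
rewrite mulr1 -prob_state; apply: le_measure; rewrite ?inE.
- exact: measurable_state.
- by apply: measurableI => //; exact: measurable_state.
- by move=> w /= sf; rewrite sf.
Qed.

End Transfer.

Lemma uniform_prob_itvco (R : realType) (a b : R) : 0 <= a -> a <= b -> b <= 1 ->
  uniform_prob (@ltr01 R) `[a, b[%classic = (b - a)%:E.
Proof.
move=> a0 ab b1; rewrite /uniform_prob.
rewrite (eq_integral (cst 1%E)); last first.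
  move=> x; rewrite inE /= in_itv /= => /andP[ax xb].
  by rewrite /uniform_pdf (le_trans a0 ax) (ltW (lt_le_trans xb b1)) subr0 invr1.
rewrite integral_cst //= mul1e.
rewrite lebesgue_measure_itv /= lte_fin; case: ltP => // ba.
by congr EFin; apply/eqP; rewrite eq_sym subr_eq0 eq_le ba ab.
Qed.

(** * Time cells, vertex classes and the schedule of phases *)

Section Cells.
Context {R : realType} (K : nat) (tau : nat -> R).
Hypothesis tau_homo : {homo tau : i j / (i <= j)%N >-> i <= j}.
Hypotheses (tau0 : 0 <= tau 0%N) (tauK : tau K <= 1).

(** The extra index [ord_max] collects every time outside [[tau 0, tau K)]. *)
Definition cell (t : R) : 'I_K.+1 :=
  if [pick i : 'I_K | tau i <= t < tau i.+1] is Some i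
  then widen_ord (leqnSn K) i else ord_max.

Lemma cellP (y : 'I_K.+1) t : (y < K)%N ->
  cell t = y <-> tau y <= t < tau y.+1.
Proof.
move=> yK; rewrite /cell; case: pickP => [i /andP[ti it]|nop]; last first.
  split=> [E|]; first by move: yK; rewrite -E /= ltnn.
  by have := nop (Ordinal yK) => /= ->.
split=> [<-|/andP[ty yt]] /=; first by rewrite ti it.
apply: val_inj => /=; have [iy|yi|//] := ltngtP i y.
  by have := le_lt_trans ty (lt_le_trans it (tau_homo iy)); rewrite ltxx.
by have := le_lt_trans ti (lt_le_trans yt (tau_homo yi)); rewrite ltxx.
Qed.

Lemma cell_lt t t' : (cell t < cell t')%N -> (cell t' < K)%N -> t <= t'.
Proof.
move=> tt' t'K; have tK := ltn_trans tt' t'K.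
have /andP[_ h1] := (cellP t tK).1 erefl.
have /andP[h2 _] := (cellP t' t'K).1 erefl.
exact: le_trans (ltW h1) (le_trans (tau_homo tt') h2).
Qed.

Let cellE (y : 'I_K.+1) : (y < K)%N -> [set t | cell t = y] = `[tau y, tau y.+1[%classic.
Proof.
move=> yK; apply/seteqP; split=> t /=; rewrite in_itv /=; [move/(cellP t yK)|move=> h; apply/(cellP t yK)]; exact.
Qed.

Lemma measurable_cell (y : 'I_K.+1) : measurable [set t | cell t = y].
Proof.
have [yK|Ky] := ltnP y K; first by rewrite cellE //; exact: measurable_itv.
have -> : [set t | cell t = y] = ~` \bigcup_(i in [set i : 'I_K.+1 | (i < K)%N]) [set t | cell t = i].
  have yE : y = ord_max by apply: val_inj => /=; apply/eqP; rewrite eqn_leq Ky -ltnS ltn_ord.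
  apply/seteqP; split=> t /=.
    by move=> ty [i /= iK]; rewrite ty yE => E; move: iK; rewrite -E /= ltnn.
  move=> h; apply: contrapT => ne; apply: h; exists (cell t) => //=.
  rewrite ltn_neqAle -ltnS ltn_ord andbT; apply: contra_notN ne => /eqP E.
  by rewrite yE; apply: val_inj.
apply: measurableC; apply: fin_bigcup_measurable => [|i /= iK]; first exact: finite_finset.
by rewrite cellE //; exact: measurable_itv.
Qed.

Lemma cell_prob_cell (y : 'I_K.+1) : (y < K)%N ->
  cell_prob cell y = tau y.+1 - tau y.
Proof.
move=> yK; rewrite /cell_prob cellE // uniform_prob_itvco //.
- exact: le_trans (tau_homo (leq0n _)).
- exact: tau_homo.
- exact: le_trans (tau_homo yK) tauK.
Qed.

End Cells.

Lemma quarter_subproof (n m : nat) (j : 'I_4) (i : 'I_m) :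
  (4 * m <= n)%N -> (j * m + i < n)%N.
Proof. by move=> mn; have := ltn_ord i; have := ltn_ord j; nia. Qed.

Definition quarter (n m : nat) (mn : (4 * m <= n)%N) (j : 'I_4) (i : 'I_m) : 'I_n :=
  Ordinal (quarter_subproof j i mn).

Lemma quarter_inj (n m : nat) (mn : (4 * m <= n)%N) j i j' i' :
  quarter mn j i = quarter mn j' i' -> j = j' /\ i = i'.
Proof.
case=> E; have im := ltn_ord i; have i'm := ltn_ord i'.
have m0 : (0 < m)%N by exact: leq_ltn_trans im.
have jj' : j = j' :> nat.
  have quo (k l : nat) : (l < m)%N -> ((k * m + l) %/ m)%N = k.
    by move=> lm; rewrite divnMDl // divn_small // addn0.
  by rewrite -(quo j i) // -(quo j' i') // E.
split; apply: val_inj => //=; apply/eqP.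
by rewrite -(eqn_add2l (j * m)) E jj'.
Qed.

Section Schedule.
Variable N : nat.

Definition ncells := N.*2.+2.
Local Notation K := ncells.

(** Reversed, because the initial phase is explored backwards in time from the cycle. *)
Definition cells_in : seq 'I_K.+1 := [seq inord i | i <- rev (iota 0 N)].
Definition cells_out : seq 'I_K.+1 := [seq inord i | i <- iota N.+2 N].

Lemma cell_inordE (i : nat) : (i < K)%N -> (inord i : 'I_K.+1) = i :> nat.
Proof. by move=> iK; rewrite inordK // ltnW. Qed.

Lemma mem_in_range i : i \in rev (iota 0 N) -> (i < N)%N.
Proof. by rewrite mem_rev mem_iota. Qed.

Lemma mem_out_range i : i \in iota N.+2 N -> (N.+2 <= i < K)%N.
Proof. by rewrite mem_iota /ncells; lia. Qed.

Lemma ltn_ncells : (N < K)%N. Proof. by rewrite /ncells; lia. Qed.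

Lemma ltnS_ncells : (N.+1 < K)%N. Proof. by rewrite /ncells; lia. Qed.

Lemma uniq_cells_in : uniq cells_in.
Proof.
rewrite map_inj_in_uniq ?rev_uniq ?iota_uniq // => i j /mem_in_range iN /mem_in_range jN.
by move/(congr1 val); rewrite /= !cell_inordE // /ncells; lia.
Qed.

Lemma uniq_cells_out : uniq cells_out.
Proof.
rewrite map_inj_in_uniq ?iota_uniq // => i j /mem_out_range iN /mem_out_range jN.
by move/(congr1 val); rewrite /= !cell_inordE //; lia.
Qed.

Lemma range_cells_in : all (fun c : 'I_K.+1 => 0 <= c < N)%N cells_in.
Proof. by apply/allP => c /mapP[i /mem_in_range iN ->]; rewrite cell_inordE // /ncells; lia. Qed.

Lemma range_cells_out : all (fun c : 'I_K.+1 => N.+2 <= c < K)%N cells_out.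
Proof. by apply/allP => c /mapP[i /mem_out_range iN ->]; rewrite cell_inordE //; case/andP: iN. Qed.

Lemma pairwise_cells_in : pairwise (fun c d : 'I_K.+1 => d < c)%N cells_in.
Proof.
rewrite pairwise_map; apply: (@sub_in_pairwise _ [pred i | i < N]%N gtn).
- by move=> i j iN jN /= ji; rewrite !cell_inordE //; move: iN jN; rewrite !inE /ncells; lia.
- by apply/allP => i /mem_in_range.
- rewrite -sorted_pairwise; last by move=> a b c /= ? ?; lia.
  by rewrite rev_sorted; apply: iota_ltn_sorted.
Qed.

Lemma pairwise_cells_out : pairwise (fun c d : 'I_K.+1 => c < d)%N cells_out.
Proof.
rewrite pairwise_map; apply: (@sub_in_pairwise _ [pred i | i < K]%N ltn).
- by move=> i j iN jN /= ij; rewrite !cell_inordE.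
- by apply/allP => i /mem_out_range /andP[].
- by rewrite -sorted_pairwise ?iota_ltn_sorted //; exact: ltn_trans.
Qed.

End Schedule.

(** * Explicit lower bound for the probability of an optimal spanner *)

Section Quantitative.
Context d (T : measurableType d) (R : realType) (P : probability T R).
Variables (n : nat) (p : R) (G : T -> tgraph 'I_n R).
Hypothesis FG : is_Fnp P p G.
Variables (m N : nat) (h q : R).
Hypotheses (mn : (4 * m <= n)%N) (m0 : (0 < m)%N).
Hypotheses (h01 : 0 <= h <= 1) (q01 : 0 < q <= 1) (p01 : 0 < p <= 1).
Hypothesis mass : 2 * (N%:R * h) + 2 * q <= p.
Hypothesis rho0 : 0 <= @rho R 'I_n h.

Local Notation K := (ncells N).

(* Cells [0 .. N-1] carry the in-forest, [N] and [N.+1] the 4-cycle, and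
   [N.+2 .. K-1] the out-forest.  Cell [i] has length [w i / p], so that a pair
   is an edge labelled in cell [i] with probability [w i], whatever [p] is. *)
Let w i : R := if (i == N) || (i == N.+1) then q else h.
Let tau i : R := (\sum_(k < i) w k) / p.

Let w_ge0 i : 0 <= w i.
Proof. by rewrite /w; case: ifP => _; [case/andP: q01 => /ltW|case/andP: h01]. Qed.

Let tauS i : tau i.+1 - tau i = w i / p.
Proof. by rewrite /tau big_ord_recr /= mulrDl addrAC subrr add0r. Qed.

Let tau_homo : {homo tau : i j / (i <= j)%N >-> i <= j}.
Proof.
apply: homo_leq => // [x y z|i]; first exact: le_trans.
by rewrite -subr_ge0 tauS divr_ge0 //; case/andP: p01 => /ltW.
Qed.

Let tauK : tau K <= 1.
Proof.
case/andP: p01 => p0 _; rewrite /tau ler_pdivrMr // mul1r; apply: le_trans mass.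
rewrite le_eqVlt; apply/orP; left; apply/eqP.
have E1 : \sum_(i < N) w i = N%:R * h.
  rewrite (eq_bigr (fun=> h)) ?sumr_const ?card_ord ?mulr_natl // => i _.
  by rewrite /w; have := ltn_ord i; case: ifP => //; lia.
have E3 : \sum_(i < N) w (N + 2 + i)%N = N%:R * h.
  rewrite (eq_bigr (fun=> h)) ?sumr_const ?card_ord ?mulr_natl // => i _.
  by rewrite /w; case: ifP => //; lia.
have E2 : \sum_(i < 2) w (N + i)%N = 2 * q.
  by rewrite !big_ord_recl big_ord0 /= /w !addn0 addn1 !eqxx orbT /=; ring.
have -> : K = (N + 2 + N)%N by rewrite /ncells; lia.
by rewrite !big_split_ord /= E1 E2 E3; ring.
Qed.

Let w_out i : (i < N)%N || (N.+2 <= i)%N -> w i = h.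
Proof. by rewrite /w; case: ifP => //; lia. Qed.

Let kappa := cell K tau.
(** Taking [none] to be [ord_max] merges absent edges with edges labelled outside the schedule.
    Every cell in use thus has index below [K] and certifies an edge. *)
Let law := @state_law R n p _ ord_max kappa.

Let law_ge0 e y : 0 <= law e y.
Proof.
rewrite /law /state_law; case: ifP => // _; case/andP: p01 => p0 p1.
by rewrite addr_ge0 // mulr_ge0 ?subr_ge0 ?(ltW p0) // fine_ge0.
Qed.

Let law_sum e : \sum_y law e y = 1.
Proof.
rewrite /law /state_law; case: (#|e| == 2%N).
  rewrite big_split /= -!mulr_sumr sum_cell_prob; last exact: measurable_cell.
  rewrite (bigD1 ord_max) //= eqxx big1 ?addr0; last by move=> y /negbTE ->.
  by rewrite !mulr1 addrC subrK.
by rewrite (bigD1 ord_max) //= eqxx big1 ?addr0 // => y /negbTE ->.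
Qed.

Let law_cell (e : {set 'I_n}) (i : nat) : #|e| = 2%N -> (i < K)%N -> law e (inord i) = w i.
Proof.
move=> e2 iK; rewrite /law /state_law e2 eqxx.
have iE := cell_inordE iK.
have -> : (inord i == ord_max :> 'I_K.+1) = false.
  by apply/negbTE; rewrite -val_eqE /= iE ltn_eqF.
rewrite mulr0 addr0 cell_prob_cell // ?iE //; last by rewrite /tau big_ord0 mul0r.
by rewrite tauS mulrC divfK // gt_eqF //; case/andP: p01.
Qed.

Lemma prob_has_optimal_spanner_ge :
  ((1 - 4 * (n%:R * (@rho R 'I_n h ^+ N * @phi R 'I_n 4)) - @theta R m q)%:E <=
   P [set w | has_optimal_spanner (G w)])%E.
Proof.
pose A : 'I_K.+1 := inord N; pose B : 'I_K.+1 := inord N.+1.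
pose E (s : {ffun {set 'I_n} -> 'I_K.+1}) :=
  [exists x, good_cycle (quarter mn) A B (cells_in N) (cells_out N) x s].
have mK : forall y, measurable [set t | kappa t = y] by exact: measurable_cell.
apply: le_trans (_ : _ <= (\sum_f weight law f * (E f)%:R)%:E)%E _.
  rewrite lee_fin.
  have := @prob_exists_good_cycle R 'I_n _ m (quarter mn) (@quarter_inj _ _ mn)
    A B (cells_in N) (cells_out N) law q h law_ge0 law_sum.
  have szo : size (cells_out N) = N by rewrite /cells_out size_map size_iota.
  have szi : size (cells_in N) = N by rewrite /cells_in size_map size_rev size_iota.
  rewrite card_ord szo szi; apply=> //.
  - move=> e j e2; rewrite /cycle_cell /A /B.
    by case: odd; rewrite law_cell ?ltn_ncells ?ltnS_ncells // /w ?eqxx ?orbT.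
  - move=> e c e2; rewrite mem_cat => /orP[]/mapP[i].
      move/mem_in_range => iN ->; rewrite law_cell ?w_out ?iN //.
      exact: ltn_trans (ltn_ncells N).
    by move/mem_out_range => /andP[Ni iK] ->; rewrite law_cell // w_out // Ni orbT.
  - exact: uniq_cells_in.
  - exact: uniq_cells_out.
apply: (prob_ge_weight FG mK).
  exact: measurable_has_optimal_spanner FG.
move=> v /existsP[x gx]; set s := state _ _ _ v in gx.
have [F [cF rF jF]] := @good_cycle_journeys _ _ m (quarter mn) A B (cells_in N) (cells_out N)
  (@nat_of_ord _) N K s x (@quarter_inj _ _ mn) (cell_inordE (ltn_ncells N)) (cell_inordE (ltnS_ncells N))
  (ltnS_ncells N) (uniq_cells_in N) (uniq_cells_out N) (range_cells_in N) (range_cells_out N) (pairwise_cells_in N) (pairwise_cells_out N) gx.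
(* A non-edge has state [ord_max], whose rank [K] is excluded by [rF]. *)
have sE e : e \in F -> e \in edges (G v).
  by move/rF; rewrite /s ffunE; case: ifP => // _ /=; rewrite ltnn.
apply: (journeys_optimal_spanner (F := F) (f := fun e => s e) (K := K)) => //.
- by apply/fintype.subsetP.
- move=> e e' eF e'F; rewrite /= /s !ffunE !sE // => lt.
  apply: (cell_lt tau_homo lt).
  by have := rF _ e'F; rewrite /s ffunE sE.
Qed.

End Quantitative.

(** * Asymptotics *)

Lemma expR_opp_le (R : realType) (x : R) : 0 <= x -> expR (- x) <= (1 + x)^-1.
Proof.
move=> x0; rewrite expRN lef_pV2 ?posrE ?expR_gt0 //; last by rewrite ltr_pwDl.
exact: expR_ge1Dx.
Qed.

(** With [y = m * q >= L / 2], [m >= 1] and [L >= 1], the three terms of [theta] are at most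
    [8 / L], [16 / L] and [16 / L]. *)
Lemma theta_le (R : realType) (m : nat) (q L : R) : (0 < m)%N -> 1 <= L ->
  L / 2 <= m%:R * q -> @theta R m q <= 40 / L.
Proof.
move=> m0 L1 mq; have m1 : 1 <= m%:R :> R by rewrite -[1]/(1%:R) ler_nat.
have L0 : 0 < L by lra.
rewrite /theta; move: (m%:R : R) m1 mq => M M1; set y := M * q => Ly.
have y0 : 0 < y by lra.
have inv (a b : R) : 0 < a -> a <= b -> b^-1 <= a^-1.
  by move=> a0 ab; rewrite lef_pV2 ?posrE //; apply: lt_le_trans ab.
have -> : M ^+ 2 * q = M * y by rewrite /y; ring.
have -> : M ^+ 3 * q ^+ 2 = M * y ^+ 2 by rewrite /y; ring.
have -> : M ^+ 4 * q ^+ 4 = y ^+ 4 by rewrite /y; ring.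
clearbody y.
have h1 : (M * y)^-1 <= (L / 2)^-1 by apply: inv; nra.
have h2 : (M * y ^+ 2)^-1 <= (L / 4)^-1.
  apply: inv; first lra.
  have : L ^+ 2 / 4 <= y ^+ 2 by nra.
  have : L <= L ^+ 2 by nra.
  by move: (y ^+ 2) (L ^+ 2) => a b; nra.
have h3 : (y ^+ 4)^-1 <= (L / 16)^-1.
  apply: inv; first lra.
  have e4 : y ^+ 4 = (y ^+ 2) ^+ 2 by ring.
  have : L ^+ 2 / 4 <= y ^+ 2 by nra.
  have : L <= L ^+ 2 by nra.
  by rewrite e4; move: (y ^+ 2) (L ^+ 2) => a b; nra.
have -> : 40 / L = 4 * (L / 2)^-1 + 4 * (L / 4)^-1 + (L / 16)^-1.
  by field; rewrite gt_eqF.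
by rewrite mul1r; lra.
Qed.

(** Replacing [n] by [n - 1] costs [T] and the denominator costs about [T ^+ 2]; both are at most
    [1]. *)
Lemma growth_exponent (R : realType) (n T : R) : 1 <= n -> 0 <= T <= 1 ->
  n * T - 2 <= (n - 1) * T / (1 + T / n).
Proof.
move=> n1 /andP[T0 T1].
have Tn : 0 <= T / n by rewrite divr_ge0 //; lra.
have E : n * (T / n) = T by rewrite mulrC divfK // gt_eqF //; lra.
rewrite ler_pdivlMr; last lra.
move: (T / n) Tn E => x x0 E; nra.
Qed.

(** In [44], the two growth phases account for [4], since [4 * eta <= 4 / L], and the cycle variance
    [theta] for [40]. *)
Lemma spanner_prob_bound d (T : measurableType d) (R : realType)
    (P : probability T R) (n : nat) (p : R) (G : T -> tgraph 'I_n R) :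
  is_Fnp P p G -> p <= 1 -> (8 <= n)%N ->
  let L : R := ln n%:R `^ (4 / 5) in 1 <= L ->
  4 * ln n%:R / n%:R + epsilon R n <= p ->
  ((1 - 44 / L)%:E <= P [set w | has_optimal_spanner (G w)])%E.
Proof.
have n48 : (8 <= n)%N -> (n <= n %/ 4 * 8)%N by lia.
have sq (x : R) : 8 <= x -> x - 1 <= x ^+ 2 by nra.
move=> FG p1 n8 L L1; rewrite /epsilon -/L => hp.
have n0 : (0 < n)%N by exact: leq_trans n8.
have nR : 8 <= n%:R :> R by rewrite ler_nat.
have l0 : 0 <= ln n%:R :> R by apply: ln_ge0; lra.
(* With [n ^ 3] cells per phase the correction [n ^ 2 * h] in [rho] is only [t / n]. The part
   [2 * ln n] of [n * t] cancels two factors [n], one from Markov's inequality and one from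
   [phi 4 <= n]; the part [4 * L] makes the failure bound tend to [0]. *)
pose N := (n ^ 3)%N; pose t : R := (2 * ln n%:R + 4 * L) / n%:R.
pose h := t / N%:R; pose q : R := 4 * L / n%:R.
have nR0 : n%:R != 0 :> R by rewrite gt_eqF //; lra.
have NE : N%:R = n%:R ^+ 3 :> R by rewrite natrX.
have N0 : N%:R != 0 :> R by rewrite NE expf_neq0.
have t0 : 0 <= t by rewrite divr_ge0 //; lra.
have q0 : 0 < q by rewrite divr_gt0 //; lra.
have Nh : N%:R * h = t by rewrite mulrC divfK.
have tq : 2 * t + 2 * q <= p.
  apply: le_trans hp; rewrite le_eqVlt; apply/orP; left; apply/eqP.
  by rewrite /t /q; field.
have t1 : t <= 1 by lra.
have h0 : 0 <= h by rewrite divr_ge0.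
have N1 : 1 <= N%:R :> R by rewrite -[1]/(1%:R) ler_nat expn_gt0 n0.
have h1 : h <= 1.
  by rewrite ler_pdivrMr ?mul1r ?(le_trans t1) // (lt_le_trans ltr01).
have n2h : n%:R ^+ 2 * h = t / n%:R by rewrite /h NE; field.
have tn0 : 0 <= t / n%:R by rewrite divr_ge0.
have rhoE : @rho R 'I_n h = 1 - (n%:R - 1) * h / (1 + t / n%:R).
  by rewrite /rho card_ord n2h.
have rho0 : 0 <= @rho R 'I_n h.
  rewrite rhoE subr_ge0 ler_pdivrMr; last lra.
  rewrite mul1r -n2h; apply: (@le_trans _ _ (n%:R ^+ 2 * h)); last by rewrite lerDr.
  by apply: ler_wpM2r => //; exact: sq.
have mn : (4 * (n %/ 4) <= n)%N by rewrite mulnC leq_trunc_div.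
have m0 : (0 < n %/ 4)%N by rewrite divn_gt0 //; exact: leq_trans n8.
apply: le_trans (prob_has_optimal_spanner_ge FG (N := N) (q := q) mn m0 _ _ _ _ rho0) => /=.
- rewrite lee_fin.
  have th : @theta R (n %/ 4) q <= 40 / L.
    apply: theta_le => //; rewrite /q.
    (* Rounding [n / 4] down loses at most a factor 2, whence [m * q >= L / 2]. *)
    have : (n%:R / 8 <= (n %/ 4)%:R :> R).
      by rewrite ler_pdivrMr // -natrM ler_nat; exact: n48.
    move: ((n %/ 4)%:R : R) => M hM.
    have -> : L / 2 = (n%:R / 8) * (4 * L / n%:R) by field.
    by apply: ler_wpM2r => //; exact: ltW.
  have eta : n%:R * (@rho R 'I_n h ^+ N * @phi R 'I_n 4) <= L^-1.
    have rhoN : @rho R 'I_n h ^+ N <= expR (2 - n%:R * t).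
      apply: (@le_trans _ _ (expR (- ((n%:R - 1) * h / (1 + t / n%:R))) ^+ N)).
        apply: lerXn2r; rewrite ?nnegrE ?expR_ge0 // rhoE.
        exact: expR_ge1Dx.
      rewrite -expRM_natl ler_expR mulrN.
      have -> : N%:R * ((n%:R - 1) * h / (1 + t / n%:R)) = (n%:R - 1) * t / (1 + t / n%:R).
        by rewrite mulrA mulrCA Nh.
      by rewrite lerNl opprB; apply: growth_exponent; rewrite ?t0 //; lra.
    have phi4 : 0 <= @phi R 'I_n 4 <= n%:R.
      rewrite /phi card_ord divr_ge0 /=; [|lra|lra].
      by rewrite ler_pdivrMr; lra.
    apply: (@le_trans _ _ (n%:R * (expR (2 - n%:R * t) * n%:R))).
      case/andP: phi4 => p40 p4n; apply: ler_wpM2l => //; apply: ler_pM => //.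
      exact: exprn_ge0.
    have -> : n%:R * (expR (2 - n%:R * t) * n%:R) = expR (- (4 * L - 2)).
      have nE : n%:R = expR (ln n%:R) :> R by rewrite lnK // posrE; lra.
      rewrite {1 3}nE -!expRD; congr expR.
      by rewrite /t; field.
    apply: le_trans (expR_opp_le _) _; first lra.
    by rewrite lef_pV2 ?posrE; lra.
  have -> : 44 / L = 4 * L^-1 + 40 / L by ring.
  rewrite opprD addrA; apply: lerB => //.
  by rewrite lerD2l lerN2; apply: ler_wpM2l.
- by rewrite h0 h1.
- by rewrite q0; lra.
- by rewrite p1 andbT; lra.
- by rewrite Nh.
Qed.

Lemma ln_powR_cvgy (R : realType) (a : R) : 0 < a ->
  ln n%:R `^ a @[n --> \oo] --> +oo.
Proof.
move=> a0; apply/cvgryPge => A.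
pose B := Num.max A 0; have B0 : 0 <= B by rewrite le_max lexx orbT.
near=> n; apply: (@le_trans _ _ B); first by rewrite le_max lexx.
have -> : B = (B `^ a^-1) `^ a by rewrite -powRrM mulVf ?gt_eqF // powRr1.
have le : expR (B `^ a^-1) <= n%:R by near: n; exact: nbhs_infty_ger.
have ln_le : B `^ a^-1 <= ln n%:R.
  by rewrite -[leLHS]expRK ler_ln ?posrE ?expR_gt0 // (lt_le_trans _ le) ?expR_gt0.
apply: ge0_ler_powR => //; rewrite ?nnegrE ?powR_ge0 ?(ltW a0) //.
exact: le_trans (powR_ge0 _ _) ln_le.
Unshelve. all: by end_near. Qed.

Unset Implicit Arguments.

Theorem theorem5p7 (R : realType) (p : nat -> R)
  (hp01 : forall n : nat, 0 <= p n <= 1)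
  (hp : \forall n \near \oo, 4 * ln n%:R / n%:R + epsilon R n <= p n)
  (d : nat -> measure_display) (T : forall n : nat, measurableType (d n))
  (P : forall n : nat, probability (T n) R)
  (G : forall n : nat, T n -> tgraph 'I_n R)
  (hG : forall n : nat, is_Fnp (P n) (p n) (G n)) :
  P n [set w | has_optimal_spanner (G n w)] @[n --> \oo] --> 1%E.
Proof.
pose L n : R := ln n%:R `^ (4 / 5).
have Loo : L n @[n --> \oo] --> +oo by apply: ln_powR_cvgy; lra.
have L1 : \forall n \near \oo, 1 <= L n by move/cvgryPge : Loo; exact.
have low : (1 - 44 / L n)%:E @[n --> \oo] --> 1%E.
  apply: cvg_EFin; first by near=> n.
  have LV : (L n)^-1 @[n --> \oo] --> (0 : R).
    by apply/gtr0_cvgV0 => //; near=> n; apply: lt_le_trans ltr01 _; near: n.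
  have -> : (fine \o (fun n => (1 - 44 / L n)%:E)) = (fun n => 1 - 44 / L n) by [].
  rewrite -[X in _ --> X]subr0 -(mulr0 44).
  by apply: cvgB; [exact: cvg_cst|apply: cvgM => //; exact: cvg_cst].
(* The probability lies between [1 - 44 / L n] and [1]; the upper bound uses measurability of the
   spanner event. *)
apply: (squeeze_cvge _ low); last exact: cvg_cst.
near=> n; apply/andP; split.
  apply: (spanner_prob_bound (hG n)).
  - by case/andP: (hp01 n).
  - by near: n; exact: nbhs_infty_ge.
  - by near: n.
  - by near: n.
apply: probability_le1; exact: measurable_has_optimal_spanner (hG n).
Unshelve. all: by end_near. Qed.
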